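(* Let $1\le p\le\infty$, and let $\mathbf{L}:=L_p(X)$, where $X$ is a measure space that either has no atoms, or has exactly one atom, or has infinitely many atoms; let $\mathbf{L}$ be endowed with the $\diamond$-operation described in the context. Let $E$ be a normed space and $F$ an $\mathbf{L}$-space. Then there exists an $\mathbf{L}$-isometric isomorphism $$I:E_{\max}\otimes_{\mathbf{L}}F\to E\otimes_{pr}F$$ acting as the identity operator on the common underlying linear space $E\otimes F$ of these $\mathbf{L}$-spaces, where $E\otimes_{pr}F$ is endowed with the $\mathbf{L}$-norm described in the context.
   Context: Spaces are over $\mathbb{C}$; $\otimes$ is the algebraic tensor product and $\otimes_{pr}$ the non-completed projective tensor product of normed spaces. All measures are assumed to have a countable basis, i.e. they are $\sigma$-finite and there is a countable family of measurable sets approximating every set of finite measure in the metric $\mu(A\triangle B)$ (so there are at most countably many atoms); $X$ has positive measure. $\diamond$-operation: fix an arbitrary isometric isomorphism $i:L_p(X\times X)\to L_p(X)$ (it exists under the conditions on $X$) and put $\xi\diamond\eta:=i(\xi(s)\eta(t))$ for $\xi,\eta\in L_p(X)$. $\mathcal{B}(\mathbf{L})$ is the algebra of bounded operators on $\mathbf{L}$. For a linear space $E$, $\mathbf{L}E:=\mathbf{L}\otimes E$, with elementary tensors written $\xi x$, is a left $\mathcal{B}(\mathbf{L})$-module via $a\cdot(\xi x)=a(\xi)x$. An $\mathbf{L}$-norm on $E$ is a norm on $\mathbf{L}E$ with $\|a\cdot u\|\le\|a\|\|u\|$ for all $a\in\mathcal{B}(\mathbf{L})$, $u\in\mathbf{L}E$;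 an $\mathbf{L}$-space is a linear space with an $\mathbf{L}$-norm. The underlying normed space of an $\mathbf{L}$-space $E$ is $E$ with $\|x\|:=\|\xi x\|$ for any $\xi\in\mathbf{L}$ with $\|\xi\|=1$ (independent of $\xi$). For a normed space $E$, $E_{\max}$ is the $\mathbf{L}$-space $E$ whose $\mathbf{L}$-norm is the norm of $\mathbf{L}\otimes_{pr}E$ on $\mathbf{L}E$. For a normed space $E$ and an $\mathbf{L}$-space $F$, $E\otimes_{pr}F$ is made an $\mathbf{L}$-space by giving $\mathbf{L}(E\otimes F)$ the norm transported from $E\otimes_{pr}(\mathbf{L}F)$ (where $\mathbf{L}F$ carries its $\mathbf{L}$-norm) via the linear isomorphism $\xi(x\otimes y)\mapsto x\otimes\xi y$. For $\mathbf{L}$-spaces $E,F$, $u\in\mathbf{L}E$, $v\in\mathbf{L}F$, the element $u\diamond v\in\mathbf{L}(E\otimes F)$ is defined by bilinear extension of $\xi x\diamond\eta y:=(\xi\diamond\eta)(x\otimes y)$. $E\otimes_{\mathbf{L}}F$ is the linear space $E\otimes F$ with the $\mathbf{L}$-norm $\|U\|_{\mathbf{L}}:=\inf\{\sum_{k=1}^n\|a_k\|\|u_k\|\|v_k\|\}$, the infimum being over all representations $U=\sum_{k=1}^n a_k\cdot(u_k\diamond v_k)$, $a_k\in\mathcal{B}(\mathbf{L})$, $u_k\in\mathbf{L}E$, $v_k\in\mathbf{L}F$. A linear operator $\varphi:E\to F$ between $\mathbf{L}$-spaces is an $\mathbf{L}$-isometric isomorphism if its amplification $\varphi_\infty:\mathbf{L}E\to\mathbf{L}F$,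 $\xi x\mapsto\xi\varphi(x)$, is an isometric isomorphism. *)

(* Defs.v *)
From HB Require Import structures.
From mathcomp Require Import all_boot all_order all_algebra.
From mathcomp Require Import all_classical all_reals all_analysis.
From mathcomp Require Import measurable_realfun ess_sup_inf.
From mathcomp Require Import generic_quotient ring_quotient complex.

Set Implicit Arguments.
Unset Strict Implicit.
Unset Printing Implicit Defensive.

Import Order.TTheory GRing.Theory Num.Theory.
Import numFieldNormedType.Exports.
Import ComplexField.Normc.

Local Open Scope classical_set_scope.
Local Open Scope ring_scope.
Local Open Scope complex_scope.
Local Open Scope quotient_scope.

Section Lp_functions.
Context d (T : measurableType d) (R : realType).
Variables (mu : {measure set T -> \bar R}) (p : \bar R) (p1 : (1 <= p)%E).
Implicit Types f g : T -> R[i].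

(* Borel measurability for R[i] = R x R, which carries no measurable structure
   in the library *)
Definition cmeasurable f : Prop :=
  measurable_fun setT (fun x => complex.Re (f x)) /\
  measurable_fun setT (fun x => complex.Im (f x)).

Definition modulus f : T -> R := fun x => normc (f x).

Lemma normcRI (z : R[i]) :
  normc z = (complex.Re z ^+ 2 + complex.Im z ^+ 2) `^ (2^-1).
Proof. by case: z => a b; rewrite powR12_sqrt// addr_ge0// sqr_ge0. Qed.

Lemma normc_ge0 (z : R[i]) : 0 <= normc z.
Proof. by rewrite normcRI powR_ge0. Qed.

Lemma cmeasurable_normc f : cmeasurable f ->
  measurable_fun setT (modulus f).
Proof.
move=> [mr mi].
rewrite (_ : modulus f = (@powR R ^~ 2^-1) \o
  (fun x => complex.Re (f x) ^+ 2 + complex.Im (f x) ^+ 2)); last first.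
  by apply/funext => x; rewrite /modulus normcRI.
apply: measurableT_comp; first exact: measurable_powR.
by apply: measurable_funD; apply: measurable_funX.
Qed.

Lemma cmeasurableD f g : cmeasurable f -> cmeasurable g -> cmeasurable (f + g).
Proof.
move=> [fr fi] [gr gi]; split.
  rewrite (_ : (fun _ => _) =
    (fun x => complex.Re (f x)) \+ (fun x => complex.Re (g x))).
    exact: measurable_funD.
  by apply/funext => x /=; rewrite addrfctE raddfD.
rewrite (_ : (fun _ => _) =
  (fun x => complex.Im (f x)) \+ (fun x => complex.Im (g x))).
  exact: measurable_funD.
by apply/funext => x /=; rewrite addrfctE raddfD.
Qed.

Lemma cmeasurableZ (a : R[i]) f : cmeasurable f -> cmeasurable (a *: f).
Proof.
move=> [fr fi]; split.
  rewrite (_ : (fun _ => _) = (cst (complex.Re a) \* (fun x => complex.Re (f x)))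
    \- (cst (complex.Im a) \* (fun x => complex.Im (f x)))).
    by apply: measurable_funB; exact: measurable_funM.
  by apply/funext => x /=; rewrite scalrfctE; case: a => ? ?; case: (f x).
rewrite (_ : (fun _ => _) = (cst (complex.Re a) \* (fun x => complex.Im (f x)))
  \+ (cst (complex.Im a) \* (fun x => complex.Re (f x)))).
  by apply: measurable_funD; exact: measurable_funM.
by apply/funext => x /=; rewrite scalrfctE; case: a => ? ?; case: (f x).
Qed.

Lemma Lnorm_ge0_le (f g : T -> R) :
  measurable_fun setT f -> measurable_fun setT g ->
  (forall x, 0 <= f x) -> (forall x, f x <= g x) ->
  ('N[mu]_p[EFin \o f] <= 'N[mu]_p[EFin \o g])%E.
Proof.
move=> mf mg f0 fg.
have g0 x : 0 <= g x by exact: le_trans (f0 x) (fg x).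
rewrite unlock; case: p p1 => [r r1|_|//]; last first.
  case: ifPn => // _; apply: le_ess_sup; apply/nearW => x /=.
  by rewrite lee_fin !ger0_norm.
have r0 : 0 <= r by rewrite lee_fin in r1; exact: le_trans r1.
apply: gt0_ler_poweR.
- by rewrite invr_ge0.
- by rewrite in_itv/= leey andbT integral_ge0// => x _; exact: poweR_ge0.
- by rewrite in_itv/= leey andbT integral_ge0// => x _; exact: poweR_ge0.
apply: ge0_le_integral => //=.
- by apply/measurable_EFinP; apply: (measurableT_comp (measurable_powR _));
    exact: measurableT_comp.
- by apply/measurable_EFinP; apply: (measurableT_comp (measurable_powR _));
    exact: measurableT_comp.
- move=> x _; rewrite lee_fin !ger0_norm// ge0_ler_powR ?nnegrE//.
Qed.

Lemma Lnorm_normcD f g : cmeasurable f -> cmeasurable g ->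
  ('N[mu]_p[EFin \o modulus (f + g)%R] <=
   'N[mu]_p[EFin \o modulus f] + 'N[mu]_p[EFin \o modulus g])%E.
Proof.
move=> mf mg; apply: (le_trans _ (eminkowski _ _ _ p1)).
- apply: Lnorm_ge0_le.
  + exact/cmeasurable_normc/cmeasurableD.
  + by apply: measurable_funD; exact: cmeasurable_normc.
  + by move=> x /=; exact: normc_ge0.
  + by move=> x /=; exact: le_normcD.
- exact: cmeasurable_normc.
- exact: cmeasurable_normc.
Qed.

Lemma Lnorm_normcZ (a : R[i]) f : cmeasurable f ->
  finite_norm mu p (modulus f) ->
  ('N[mu]_p[EFin \o modulus (a *: f)%R] =
   (normc a)%:E * 'N[mu]_p[EFin \o modulus f])%E.
Proof.
move=> mf ff.
have fL : (modulus f) \in Lfun mu p.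
  by apply/andP; split; rewrite inE//=; exact: cmeasurable_normc.
have := LnormZ (Lfun_Sub p1 fL) (normc a).
rewrite ger0_norm ?normc_ge0// => <-; apply: eq_Lnorm => x /=.
by rewrite /modulus scalrfctE normcM.
Qed.

(* The unused argument lets the closure instance below, which needs p >= 1,
   be inferred from the predicate. *)
Definition LpFun (_ : (1 <= p)%E) : {pred T -> R[i]} :=
  mem [set f | cmeasurable f /\ finite_norm mu p (modulus f)].

Lemma LpFun_submod_closed : submod_closed (LpFun p1).
Proof.
split.
  rewrite inE; split; first by split; exact: measurable_cst.
  rewrite /finite_norm (_ : _ \o _ = cst 0%E); last first.
    by apply/funext => x; rewrite /= /modulus normc0.
  by rewrite Lnorm0// gt_eqF// (lt_le_trans _ p1).
move=> a f g; rewrite !inE => -[mf ff] [mg fg].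
have maf := cmeasurableZ a mf; split; first exact: cmeasurableD.
apply: (le_lt_trans (Lnorm_normcD _ _)) => //.
rewrite Lnorm_normcZ// lte_add_pinfty// lte_mul_pinfty//.
by rewrite lee_fin normc_ge0.
Qed.

HB.instance Definition _ :=
  GRing.isSubmodClosed.Build _ _ (LpFun p1) LpFun_submod_closed.

Record lpfun := LpFunction { lpfun_val :> T -> R[i] ; _ : lpfun_val \in LpFun p1 }.

HB.instance Definition _ := [isSub for lpfun_val].
HB.instance Definition _ := [Choice of lpfun by <:].
HB.instance Definition _ := [SubChoice_isSubLmodule of lpfun by <:].

End Lp_functions.

Section Lp_space.
Context d (T : measurableType d) (R : realType).
Variables (mu : {measure set T -> \bar R}) (p : \bar R) (p1 : (1 <= p)%E).
Local Notation lpfun := (lpfun mu p1).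
Implicit Types f g : lpfun.

Lemma lpfunP f : cmeasurable f /\ finite_norm mu p (modulus f).
Proof. by have := valP f; rewrite inE. Qed.

Definition lpnull : {pred lpfun} :=
  mem [set f : lpfun | \forall x \ae mu, f x = 0].

Lemma lpnull_submod_closed : submod_closed lpnull.
Proof.
split; first by rewrite inE; apply/nearW.
move=> a f g; rewrite !inE => f0 g0; near=> x.
rewrite -[LHS]/(a * f x + g x).
have -> : f x = 0 by near: x.
have -> : g x = 0 by near: x.
by rewrite mulr0 addr0.
Unshelve. all: by end_near. Qed.

HB.instance Definition _ :=
  GRing.isSubmodClosed.Build _ _ lpnull lpnull_submod_closed.

Definition Lp : Type := Quotient.quot lpnull.
HB.instance Definition _ := GRing.Zmodule.on Lp.
HB.instance Definition _ := EqQuotient.on Lp.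
HB.instance Definition _ := Choice.on Lp.

Definition Lclass f : Lp := \pi_Lp f.

Lemma Lclass_eq f g : Lclass f = Lclass g <-> \forall x \ae mu, f x = g x.
Proof.
rewrite /Lclass; split.
  move=> /eqP; rewrite -Quotient.idealrBE inE; apply: filterS => x.
  by rewrite -[_ x]/(f x - g x) => /eqP; rewrite subr_eq0 => /eqP.
move=> fg; apply/eqP; rewrite -Quotient.idealrBE inE; apply: filterS fg => x fg.
by rewrite -[LHS]/(f x - g x) fg subrr.
Qed.

Lemma LclassD f g : Lclass (f + g) = Lclass f + Lclass g.
Proof. exact: (Quotient.pi_add lpnull). Qed.

Lemma Lclass0 : Lclass 0 = 0.
Proof. by apply: (addrI (Lclass 0)); rewrite -LclassD !addr0. Qed.

Lemma Lrepr_ae f : \forall x \ae mu, repr (Lclass f) x = f x.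
Proof. by apply/Lclass_eq; rewrite /Lclass reprK. Qed.

Definition Lscale (a : R[i]) (xi : Lp) : Lp := Lclass (a *: repr xi).

Lemma LscaleE a f : Lscale a (Lclass f) = Lclass (a *: f).
Proof.
apply/Lclass_eq; apply: filterS (Lrepr_ae f) => x fx.
by rewrite -[LHS]/(a * repr (Lclass f) x) fx.
Qed.

Lemma Lclass_ind (P : Lp -> Prop) : (forall f, P (Lclass f)) -> forall xi, P xi.
Proof. by move=> H xi; rewrite -[xi]reprK; exact: H. Qed.

Lemma LscaleA a b xi : Lscale a (Lscale b xi) = Lscale (a * b) xi.
Proof. by elim/Lclass_ind: xi => f; rewrite !LscaleE scalerA. Qed.
Lemma Lscale1 : left_id 1 Lscale.
Proof. by elim/Lclass_ind => f; rewrite !LscaleE scale1r. Qed.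
Lemma LscaleDr : right_distributive Lscale +%R.
Proof.
by move=> a; elim/Lclass_ind => f; elim/Lclass_ind => g;
  rewrite !LscaleE -!LclassD LscaleE scalerDr.
Qed.
Lemma LscaleDl xi : {morph Lscale^~ xi : a b / a + b}.
Proof.
by move=> a b; elim/Lclass_ind: xi => f; rewrite !LscaleE -LclassD scalerDl.
Qed.

HB.instance Definition _ :=
  GRing.Zmodule_isLmodule.Build R[i] Lp LscaleA Lscale1 LscaleDr LscaleDl.

Lemma LclassZ a f : Lclass (a *: f) = a *: Lclass f.
Proof. by rewrite -LscaleE. Qed.

Definition lpnorm f : R := fine ('N[mu]_p[EFin \o modulus f])%E.

Lemma lpnormE f : (lpnorm f)%:E = ('N[mu]_p[EFin \o modulus f])%E.
Proof.
rewrite fineK// ge0_fin_numE ?Lnorm_ge0//; exact: (lpfunP f).2.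
Qed.

Lemma lpnormD f g : lpnorm (f + g) <= lpnorm f + lpnorm g.
Proof.
have [[mf _] [mg _]] := (lpfunP f, lpfunP g).
by rewrite -lee_fin EFinD !lpnormE; exact: Lnorm_normcD.
Qed.

Lemma lpnormZ a f : lpnorm (a *: f) = normc a * lpnorm f.
Proof.
have [mf ff] := lpfunP f.
by apply: EFin_inj; rewrite EFinM !lpnormE -Lnorm_normcZ.
Qed.

Lemma lpnorm_eq0 f : lpnorm f = 0 -> Lclass f = 0.
Proof.
have [mf ff] := lpfunP f.
move=> nf0; have Nf0 := lpnormE f; rewrite nf0 in Nf0.
rewrite -Lclass0.
apply/Lclass_eq.
have : \forall x \ae mu, setT x -> (modulus f x)%:E = 0%E.
  apply: (Lnorm_eq0_eq0 _ _ (esym Nf0)); last exact: lt_le_trans p1.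
  exact/measurable_EFinP/cmeasurable_normc.
by apply: filterS => x /(_ I) fx; apply: eq0_normc; case: fx.
Qed.

Lemma lpnorm_ae f g : (\forall x \ae mu, f x = g x) -> lpnorm f = lpnorm g.
Proof.
move=> fg.
have N0 (h : lpfun) : (\forall x \ae mu, h x = 0) -> lpnorm h = 0.
  move=> h0; have [mh _] := lpfunP h; have mm := cmeasurable_normc mh.
  have h0' : \forall x \ae mu, modulus h x = 0.
    by apply: filterS h0 => x hx; rewrite /modulus hx normc0.
  apply: EFin_inj; rewrite lpnormE.
  move: (modulus h) mm h0' => m mm m0; rewrite unlock; case: p p1 => [r r1|_|//]; last first.
    case: ifPn => // mu0; apply: ess_sup_ae_cst => //.
    by apply: filterS m0 => x /= ->; rewrite normr0.
  have r0 : r != 0 by rewrite gt_eqF// (lt_le_trans ltr01)// -lee_fin.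
  rewrite (ae_eq_integral (cst 0%E))//.
  - by rewrite integral0 poweR0r// invr_neq0.
  - apply/measurable_EFinP; apply: (measurableT_comp (measurable_powR _)).
    exact: measurableT_comp.
  - by apply: filterS m0 => x /= -> _; rewrite normr0 powR0.
have le (h k : lpfun) : (\forall x \ae mu, h x = k x) -> lpnorm h <= lpnorm k.
  move=> hk; rewrite -[h](subrK k) (le_trans (lpnormD _ _))// N0 ?add0r//.
  by apply: filterS hk => x hk; rewrite -[LHS]/(h x - k x) hk subrr.
by apply/eqP; rewrite eq_le !le//; apply: filterS fg.
Qed.

Definition Lpnorm (xi : Lp) : R[i] := (lpnorm (repr xi))%:C.

Lemma LpnormE f : Lpnorm (Lclass f) = (lpnorm f)%:C.
Proof. by rewrite /Lpnorm (lpnorm_ae (Lrepr_ae f)). Qed.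

Lemma LpnormD xi eta : Lpnorm (xi + eta) <= Lpnorm xi + Lpnorm eta.
Proof.
elim/Lclass_ind: xi => f; elim/Lclass_ind: eta => g.
by rewrite -LclassD !LpnormE -rmorphD /= lecR lpnormD.
Qed.

Lemma LpnormZ a xi : Lpnorm (a *: xi) = `|a| * Lpnorm xi.
Proof.
by elim/Lclass_ind: xi => f; rewrite -LclassZ !LpnormE lpnormZ rmorphM.
Qed.

Lemma Lpnorm0_eq0 xi : Lpnorm xi = 0 -> xi = 0.
Proof.
by elim/Lclass_ind: xi => f; rewrite LpnormE => -[]; exact: lpnorm_eq0.
Qed.

HB.instance Definition _ :=
  Lmodule_isNormed.Build R[i] Lp LpnormD LpnormZ Lpnorm0_eq0.

End Lp_space.

Definition bilinear_map (K : fieldType) (V W Z : lmodType K)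
    (g : V -> W -> Z) : Prop :=
  (forall v, linear (g v)) /\ (forall w, linear (g^~ w)).

Section tensor_product.
Variables (K : fieldType) (V W : lmodType K).

Definition formal_sum (Z : zmodType) (g : V -> W -> Z) (s : seq (V * W)) : Z :=
  \sum_(x <- s) g x.1 x.2.

(* The algebraic tensor product is the set of finite formal sums of pairs (x, y)
   modulo the kernel of the universal bilinear map: two formal sums are
   identified when every bilinear map takes the same value on them.  The
   universal property is [tlift_linear], [tlift_tens], [tlift_unique]. *)
Definition tensor_eq : rel (seq (V * W)) := fun s t =>
  `[< forall (Z : lmodType K) (g : V -> W -> Z), bilinear_map g ->
        formal_sum g s = formal_sum g t >].

Lemma tensor_eq_refl : reflexive tensor_eq.
Proof. by move=> s; apply/asboolP. Qed.

Lemma tensor_eq_sym : symmetric tensor_eq.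
Proof.
by move=> s t; apply/asboolP/asboolP => st Z g bg; rewrite (st Z g bg).
Qed.

Lemma tensor_eq_trans : transitive tensor_eq.
Proof.
move=> t s u /asboolP st /asboolP tu; apply/asboolP => Z g bg.
by rewrite st// tu.
Qed.

Canonical tensor_equiv :=
  EquivRel tensor_eq tensor_eq_refl tensor_eq_sym tensor_eq_trans.

Definition tensor : Type := {eq_quot tensor_eq}.
HB.instance Definition _ := Choice.on tensor.
HB.instance Definition _ := EqQuotient.on tensor.

Definition tclass (s : seq (V * W)) : tensor := \pi_tensor s.

Definition tens (x : V) (y : W) : tensor := tclass [:: (x, y)].

(* Total in [g], but meaningful only for bilinear [g]: otherwise the value depends
   on the chosen representative. *)
Definition tlift (Z : lmodType K) (g : V -> W -> Z) (u : tensor) : Z :=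
  formal_sum g (repr u).

Lemma tclassP s t : tclass s = tclass t <->
  forall (Z : lmodType K) (g : V -> W -> Z), bilinear_map g ->
    formal_sum g s = formal_sum g t.
Proof.
rewrite /tclass; split; first by move=> /eqP; rewrite eqmodE => /asboolP.
by move=> st; apply/eqP; rewrite eqmodE; apply/asboolP.
Qed.

Lemma tclass_ind (P : tensor -> Prop) : (forall s, P (tclass s)) -> forall u, P u.
Proof. by move=> H u; rewrite -[u]reprK; exact: H. Qed.

Lemma tlift_class (Z : lmodType K) (g : V -> W -> Z) s :
  bilinear_map g -> tlift g (tclass s) = formal_sum g s.
Proof. by move=> bg; apply: (tclassP _ _).1 => //; rewrite /tclass reprK. Qed.

Definition tadd (u v : tensor) : tensor := tclass (repr u ++ repr v).
Definition tscale (a : K) (u : tensor) : tensor :=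
  tclass [seq (a *: x.1, x.2) | x <- repr u].
Definition topp (u : tensor) : tensor := tscale (-1) u.
Definition tzero : tensor := tclass [::].

Lemma formal_sum_cat (Z : zmodType) (g : V -> W -> Z) s t :
  formal_sum g (s ++ t) = formal_sum g s + formal_sum g t.
Proof. by rewrite /formal_sum big_cat. Qed.

Lemma formal_sum_scale (Z : lmodType K) (g : V -> W -> Z) a s :
  bilinear_map g ->
  formal_sum g [seq (a *: x.1, x.2) | x <- s] = a *: formal_sum g s.
Proof.
move=> [_ bg]; rewrite /formal_sum big_map scaler_sumr; apply: eq_bigr => x _.
have bl := bg x.2.
have g0 : g 0 x.2 = 0.
  by have := bl (-1) 0 0; rewrite /= scaler0 addr0 scaleN1r addNr.
by have := bl a x.1 0; rewrite /= addr0 g0 addr0.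
Qed.

Lemma taddE s t : tadd (tclass s) (tclass t) = tclass (s ++ t).
Proof.
apply/tclassP => Z g bg; rewrite !formal_sum_cat.
by rewrite -!(tlift_class _ bg) /tclass !reprK.
Qed.

Lemma tscaleE a s :
  tscale a (tclass s) = tclass [seq (a *: x.1, x.2) | x <- s].
Proof.
apply/tclassP => Z g bg; rewrite !formal_sum_scale//.
by rewrite -!(tlift_class _ bg) /tclass !reprK.
Qed.

Lemma taddA : associative tadd.
Proof.
elim/tclass_ind => s; elim/tclass_ind => t; elim/tclass_ind => u.
by rewrite !taddE catA.
Qed.
Lemma taddC : commutative tadd.
Proof.
elim/tclass_ind => s; elim/tclass_ind => t; rewrite !taddE.
by apply/tclassP => Z g bg; rewrite !formal_sum_cat addrC.
Qed.
Lemma tadd0 : left_id tzero tadd.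
Proof. by elim/tclass_ind => s; rewrite taddE. Qed.
Lemma taddN : left_inverse tzero topp tadd.
Proof.
elim/tclass_ind => s; rewrite /topp tscaleE taddE; apply/tclassP => Z g bg.
by rewrite formal_sum_cat formal_sum_scale// scaleN1r addNr /formal_sum big_nil.
Qed.

HB.instance Definition _ := GRing.isZmodule.Build tensor taddA taddC tadd0 taddN.

Lemma tclassD s t : tclass (s ++ t) = tclass s + tclass t.
Proof. by rewrite -taddE. Qed.

Lemma tscaleA a b u : tscale a (tscale b u) = tscale (a * b) u.
Proof.
elim/tclass_ind: u => s; rewrite !tscaleE; apply/tclassP => Z g bg.
by rewrite !formal_sum_scale// scalerA.
Qed.
Lemma tscale1 : left_id 1 tscale.
Proof.
elim/tclass_ind => s; rewrite !tscaleE; apply/tclassP => Z g bg.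
by rewrite !formal_sum_scale// scale1r.
Qed.
Lemma tscaleDr : right_distributive tscale +%R.
Proof.
move=> a; elim/tclass_ind => s; elim/tclass_ind => t.
rewrite -tclassD !tscaleE -tclassD; apply/tclassP => Z g bg.
by rewrite formal_sum_scale// !formal_sum_cat scalerDr !formal_sum_scale.
Qed.
Lemma tscaleDl u : {morph tscale^~ u : a b / a + b}.
Proof.
move=> a b; elim/tclass_ind: u => s; rewrite !tscaleE -tclassD.
by apply/tclassP => Z g bg; rewrite formal_sum_cat !formal_sum_scale// scalerDl.
Qed.

HB.instance Definition _ :=
  GRing.Zmodule_isLmodule.Build K tensor tscaleA tscale1 tscaleDr tscaleDl.

Lemma tclassZ a s : tclass [seq (a *: x.1, x.2) | x <- s] = a *: tclass s.
Proof. by rewrite -tscaleE. Qed.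

Lemma tens_bilinear : bilinear_map tens.
Proof.
split=> [x a y y'|y a x x'].
  rewrite /tens -tclassZ -tclassD; apply/tclassP => Z g bg.
  rewrite formal_sum_cat formal_sum_scale// /formal_sum !big_seq1 /=.
  exact: bg.1.
rewrite /tens -tclassZ -tclassD; apply/tclassP => Z g bg.
rewrite formal_sum_cat formal_sum_scale// /formal_sum !big_seq1 /=.
exact: bg.2.
Qed.

Lemma tclassE s : tclass s = \sum_(x <- s) tens x.1 x.2.
Proof.
elim: s => [|[x y] s IH]; first by rewrite big_nil.
by rewrite big_cons -IH -tclassD.
Qed.

Lemma tlift_linear (Z : lmodType K) (g : V -> W -> Z) :
  bilinear_map g -> linear (tlift g).
Proof.
move=> bg a; elim/tclass_ind => s; elim/tclass_ind => t.
by rewrite -tclassZ -tclassD !tlift_class// formal_sum_cat formal_sum_scale.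
Qed.

Lemma tlift_tens (Z : lmodType K) (g : V -> W -> Z) x y :
  bilinear_map g -> tlift g (tens x y) = g x y.
Proof. by move=> bg; rewrite tlift_class// /formal_sum big_seq1. Qed.

Lemma tlift_unique (Z : lmodType K) (g : V -> W -> Z) (h : {linear tensor -> Z}) :
  bilinear_map g -> (forall x y, h (tens x y) = g x y) -> h =1 tlift g.
Proof.
move=> bg hg; elim/tclass_ind => s; rewrite tlift_class// tclassE linear_sum.
by apply: eq_bigr => x _; rewrite hg.
Qed.

End tensor_product.

Section product_function.
Context d (X : measurableType d) (R : realType).
Variable mu : {sigma_finite_measure set X -> \bar R}.
Variables (p : \bar R) (p1 : (1 <= p)%E).
Local Notation mu2 := (mu \x mu)%E.

Lemma ae_prod1 (P : X -> Prop) :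
  (\forall s \ae mu, P s) -> \forall z \ae mu2, P z.1.
Proof.
move=> [N [mN N0 PN]]; exists (N `*` setT); split.
- exact: measurableX.
- by rewrite product_measure1E// -[RHS](mul0e (mu setT)); congr (_ * _)%E.
- by move=> z /= Pz; split => //; exact: PN.
Qed.

Lemma ae_prod2 (P : X -> Prop) :
  (\forall s \ae mu, P s) -> \forall z \ae mu2, P z.2.
Proof.
move=> [N [mN N0 PN]]; exists (setT `*` N); split.
- exact: measurableX.
- by rewrite product_measure1E// -[RHS](mule0 (mu setT)); congr (_ * _)%E.
- by move=> z /= Pz; split => //; exact: PN.
Qed.

Definition prodfun (f g : X -> R[i]) : X * X -> R[i] := fun z => f z.1 * g z.2.

Lemma cmeasurable_prodfun f g :
  cmeasurable f -> cmeasurable g -> cmeasurable (prodfun f g).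
Proof.
move=> [fr fi] [gr gi].
have m1 (h : X -> R) : measurable_fun setT h ->
    measurable_fun setT (fun z : X * X => h z.1).
  by move=> mh; apply: measurableT_comp.
have m2 (h : X -> R) : measurable_fun setT h ->
    measurable_fun setT (fun z : X * X => h z.2).
  by move=> mh; apply: measurableT_comp.
split.
  rewrite (_ : (fun _ => _) = (fun z : X * X =>
    complex.Re (f z.1) * complex.Re (g z.2) -
    complex.Im (f z.1) * complex.Im (g z.2))); last first.
    by apply/funext => z; rewrite /prodfun; case: (f _) => ? ?; case: (g _).
  by apply: measurable_funB; apply: measurable_funM; [exact: (m1 _ fr)|
    exact: (m2 _ gr)|exact: (m1 _ fi)|exact: (m2 _ gi)].
rewrite (_ : (fun _ => _) = (fun z : X * X =>
  complex.Re (f z.1) * complex.Im (g z.2) +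
  complex.Im (f z.1) * complex.Re (g z.2))); last first.
  by apply/funext => z; rewrite /prodfun; case: (f _) => ? ?; case: (g _).
by apply: measurable_funD; apply: measurable_funM; [exact: (m1 _ fr)|
  exact: (m2 _ gi)|exact: (m1 _ fi)|exact: (m2 _ gr)].
Qed.

Lemma finite_norm_prodfun f g : cmeasurable f -> cmeasurable g ->
  finite_norm mu p (modulus f) -> finite_norm mu p (modulus g) ->
  finite_norm mu2 p (modulus (prodfun f g)).
Proof.
move=> mf mg.
have mm := cmeasurable_normc (cmeasurable_prodfun mf mg).
have mf' := cmeasurable_normc mf.
have mg' := cmeasurable_normc mg.
rewrite /finite_norm unlock; case: p p1 => [r r1|_|//]; last first.
  case: ifPn => [mu0|]; last first.
    rewrite -leNgt measure_le0 => /eqP mu0 _ _.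
    have m20 : mu2 (setT `*` setT) = 0%E.
      rewrite product_measure1E// -[RHS](mule0 (mu setT)).
      by congr (_ * _)%E.
    by rewrite setXTT in m20; rewrite [X in (0 < X)%E]m20 ltxx.
  move=> fM gM; case: ifPn => // _.
  apply: (@le_lt_trans _ _ (ess_sup mu (abse \o (EFin \o modulus f)) *
    ess_sup mu (abse \o (EFin \o modulus g))))%E; last first.
    have ge0 (h : X -> R) : (0 <= ess_sup mu (abse \o (EFin \o h)))%E.
      by apply: ess_sup_gee => //; apply/nearW => x /=.
    rewrite lte_mul_pinfty// ge0_fin_numE//.
  apply/ess_supP.
  have /ae_prod1 h1 := ess_sup_ge mu (abse \o (EFin \o modulus f)).
  have /ae_prod2 h2 := ess_sup_ge mu (abse \o (EFin \o modulus g)).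
  near=> z.
  rewrite /= /modulus /prodfun normcM normrM EFinM.
  by apply: lee_pmul => //; near: z.
have r0 : (0 < r) by rewrite (lt_le_trans ltr01)// -lee_fin.
have mr (h : X -> R) : measurable_fun setT h ->
    measurable_fun setT (fun x : X => ((`|(EFin \o h) x| `^ r)%E)).
  move=> mh; apply/measurable_EFinP; apply: (measurableT_comp (measurable_powR _)).
  exact: measurableT_comp.
move=> /lty_poweRy; rewrite invr_eq0 gt_eqF// => /(_ isT) If.
move=> /lty_poweRy; rewrite invr_eq0 gt_eqF// => /(_ isT) Ig.
apply: poweR_lty.
rewrite fubini_tonelli1//; last 2 first.
- apply/measurable_EFinP; apply: (measurableT_comp (measurable_powR _)).
  exact: measurableT_comp.
- by move=> z; exact: poweR_ge0.
rewrite (_ : (fun _ => _) = (fun x =>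
  (`|(EFin \o modulus f) x| `^ r * \int[mu]_y (`|(EFin \o modulus g) y| `^ r))%E)).
  rewrite ge0_integralZr//.
  - rewrite lte_mul_pinfty// ?integral_ge0// => [x _|]; first exact: poweR_ge0.
    by rewrite ge0_fin_numE// integral_ge0// => x _; exact: poweR_ge0.
  - exact: mr.
  - by move=> x _; exact: poweR_ge0.
  - by rewrite integral_ge0// => x _; exact: poweR_ge0.
apply/funext => x; rewrite /fubini_F /=.
rewrite -ge0_integralZl//.
- apply: eq_integral => y _.
  by rewrite /modulus /prodfun /= normcM normrM powRM.
- exact: mr.
Unshelve. all: by end_near. Qed.

Lemma prodfun_LpFun (f g : lpfun mu p1) : prodfun f g \in LpFun mu2 p1.
Proof.
have [[mf ff] [mg fg]] := (lpfunP f, lpfunP g).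
by rewrite inE; split; [exact: cmeasurable_prodfun|exact: finite_norm_prodfun].
Qed.

Definition lpprod (f g : lpfun mu p1) : lpfun mu2 p1 :=
  LpFunction (prodfun_LpFun f g).

(* independent of the representatives, see [LprodE] *)
Definition Lprod (xi eta : Lp mu p1) : Lp mu2 p1 :=
  Lclass (lpprod (repr xi) (repr eta)).

Lemma LprodE (f g : lpfun mu p1) :
  Lprod (Lclass f) (Lclass g) = Lclass (lpprod f g).
Proof.
apply/Lclass_eq.
have h1 := ae_prod1 (Lrepr_ae f); have h2 := ae_prod2 (Lrepr_ae g).
near=> z; rewrite /= /prodfun; congr (_ * _); near: z; [exact: h1|exact: h2].
Unshelve. all: by end_near. Qed.

Lemma Lprod_bilinear : bilinear_map Lprod.
Proof.
split=> [xi a eta eta'|eta a xi xi'].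
  elim/Lclass_ind: xi => f; elim/Lclass_ind: eta => g; elim/Lclass_ind: eta' => h.
  rewrite -LclassZ -LclassD !LprodE -LclassZ -LclassD; congr Lclass.
  apply: val_inj; apply/funext => z /=; rewrite /prodfun.
  by rewrite -[LHS]/(f z.1 * (a * g z.2 + h z.2)) mulrDr mulrCA.
elim/Lclass_ind: xi => f; elim/Lclass_ind: eta => g; elim/Lclass_ind: xi' => h.
rewrite -LclassZ -LclassD !LprodE -LclassZ -LclassD; congr Lclass.
apply: val_inj; apply/funext => z /=; rewrite /prodfun.
by rewrite -[LHS]/((a * f z.1 + h z.1) * g z.2) mulrDl -mulrA.
Qed.

End product_function.

Section atoms.
Context d (X : measurableType d) (R : realType).
Variable mu : {measure set X -> \bar R}.

Definition countable_basis : Prop :=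
  exists D : (set X)^nat, (forall n, measurable (D n)) /\
    forall A, measurable A -> (mu A < +oo)%E ->
      forall e : R, 0 < e -> exists n, (mu (A `+` D n) < e%:E)%E.

Definition atom (A : set X) : Prop :=
  [/\ measurable A, (0 < mu A)%E &
    forall B, measurable B -> B `<=` A -> mu B = 0%E \/ mu (A `\` B) = 0%E].

Definition ae_class (A : set X) : set (set X) :=
  [set B | measurable B /\ mu (A `+` B) = 0%E].

(* Atoms are counted up to null sets. *)
Definition atoms : set (set (set X)) := ae_class @` atom.

Definition no_atoms : Prop := atoms = set0.
Definition one_atom : Prop := exists C, atoms = [set C].
Definition infinitely_many_atoms : Prop := infinite_set atoms.

End atoms.

(* The library norm of a complex normed module is R[i]-valued. *)
Definition rnorm (R : realType) (V : normedModType R[i]) (x : V) : R :=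
  complex.Re `|x|.

Definition isometric_iso (R : realType) (V W : normedModType R[i])
    (f : {linear V -> W}) : Prop :=
  bijective f /\ forall x, `|f x| = `|x|.

Section projective_norm.
Variables (R : realType) (V W : lmodType R[i]) (NV : V -> R) (NW : W -> R).

Definition is_norm (N : V -> R) : Prop :=
  [/\ forall u v, N (u + v) <= N u + N v,
      forall (a : R[i]) u, N (a *: u) = normc a * N u &
      forall u, N u = 0 -> u = 0].

Definition proj_norm (u : tensor V W) : R :=
  inf [set \sum_(x <- s) NV x.1 * NW x.2 |
        s in [set s : seq (V * W) | u = \sum_(x <- s) tens x.1 x.2]].

End projective_norm.

Section L_spaces.
Variables (R : realType) (L : normedModType R[i]).

Record bounded_op := BoundedOp {
  bop :> {linear L -> L} ;
  _ : exists M : R, forall xi, rnorm (bop xi) <= M * rnorm xi }.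

Definition opnorm (a : bounded_op) : R :=
  sup [set rnorm (a xi) | xi in [set xi : L | rnorm xi <= 1]].

Definition Lact (E : lmodType R[i]) (a : bounded_op) : tensor L E -> tensor L E :=
  tlift (fun xi x => tens (a xi) x).

Definition amplification (E F : lmodType R[i]) (phi : {linear E -> F}) :
    tensor L E -> tensor L F :=
  tlift (fun xi x => tens xi (phi x)).

(* A linear space with a real function on its tensor product with [L]; it is an
   L-space when [is_Lspace] holds.  The constructions [Lmax], [Lpr] and [Ltensor]
   below produce the data only. *)
Record Ldata := LData {
  Lcarrier :> lmodType R[i] ;
  Lnrm : tensor L Lcarrier -> R }.

Definition is_Lspace (E : Ldata) : Prop :=
  is_norm (@Lnrm E) /\
  forall (a : bounded_op) (u : tensor L E), Lnrm (Lact a u) <= opnorm a * Lnrm u.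

Definition L_isometric_iso (E F : Ldata) (phi : {linear E -> F}) : Prop :=
  bijective (amplification phi) /\
  forall U : tensor L E, Lnrm (amplification phi U) = Lnrm U.

Definition Lmax (E : normedModType R[i]) : Ldata :=
  @LData E (proj_norm (@rnorm R L) (@rnorm R E)).

(* xi (x) (x (x) y) |-> x (x) (xi (x) y), see [Lswap_tens] *)
Definition Lswap (E F : lmodType R[i]) :
    tensor L (tensor E F) -> tensor E (tensor L F) :=
  tlift (fun xi => tlift (fun x y => tens x (tens xi y))).

Definition Lpr (E : normedModType R[i]) (F : Ldata) : Ldata :=
  @LData (tensor E F)
    (fun U => proj_norm (@rnorm R E) (@Lnrm F) (Lswap U)).

Section diamond.
Variable dia : L -> L -> L.

(* the bilinear extension of [Ldiamond_tens] *)
Definition Ldiamond (E F : lmodType R[i]) (u : tensor L E) (v : tensor L F) :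
    tensor L (tensor E F) :=
  tlift (fun xi x => tlift (fun eta y => tens (dia xi eta) (tens x y)) v) u.

Definition Ltensor (E F : Ldata) : Ldata :=
  @LData (tensor E F) (fun U =>
    inf [set \sum_(t <- s) opnorm t.1.1 * Lnrm t.1.2 * Lnrm t.2 |
          s in [set s : seq (bounded_op * tensor L E * tensor L F) |
                 U = \sum_(t <- s) Lact t.1.1 (Ldiamond t.1.2 t.2)]]).

End diamond.
End L_spaces.

Section well_defined.
Variables (R : realType) (L : normedModType R[i]) (E F : lmodType R[i]).

Lemma bilinear_comp (K : fieldType) (V W V' W' : lmodType K)
    (f : {linear V -> V'}) (g : {linear W -> W'}) :
  bilinear_map (fun x y => tens (f x) (g y)).
Proof.
have [tl tr] := tens_bilinear V' W'.
split=> [x a y y'|y a x x']; rewrite linearP; [exact: tl|exact: tr].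
Qed.

Lemma Lact_linear (a : bounded_op L) : linear (@Lact R L E a).
Proof. exact: tlift_linear (bilinear_comp a idfun). Qed.

Lemma Lact_tens (a : bounded_op L) xi (x : E) :
  Lact a (tens xi x) = tens (a xi) x.
Proof. exact: tlift_tens (bilinear_comp a idfun). Qed.

Lemma amplification_linear (phi : {linear E -> F}) :
  linear (@amplification R L E F phi).
Proof. exact: tlift_linear (bilinear_comp idfun phi). Qed.

Lemma amplification_tens (phi : {linear E -> F}) (xi : L) x :
  amplification phi (tens xi x) = tens xi (phi x).
Proof. exact: tlift_tens (bilinear_comp idfun phi). Qed.

Lemma bilinear_tlift (K : fieldType) (V W Z V' : lmodType K)
    (g : V' -> V -> W -> Z) :
  (forall x, bilinear_map (g x)) ->
  (forall a x x' v w, g (a *: x + x') v w = a *: g x v w + g x' v w) ->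
  bilinear_map (fun x u => tlift (g x) u).
Proof.
move=> bg lg; split=> [x|u a x x']; first exact: tlift_linear.
elim/tclass_ind: u => s; rewrite !tlift_class// /formal_sum scaler_sumr.
by rewrite -big_split; apply: eq_bigr => y _; exact: lg.
Qed.

Lemma Lswap_bilinear :
  bilinear_map (fun (xi : L) => tlift (fun (x : E) (y : F) => tens x (tens xi y))).
Proof.
have [tl tr] := tens_bilinear L F.
have [sl sr] := tens_bilinear E (tensor L F).
apply: (@bilinear_tlift _ E F _ L (fun xi x y => tens x (tens xi y))) => [xi|a xi xi' x y].
  split=> [x a y y'|y a x x']; last exact: sr.
  by rewrite tl sl.
by rewrite tr sl.
Qed.

Lemma Lswap_linear : linear (@Lswap R L E F).
Proof. exact: tlift_linear Lswap_bilinear. Qed.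

Lemma Lswap_tens (xi : L) (x : E) (y : F) :
  Lswap (tens xi (tens x y)) = tens x (tens xi y).
Proof.
rewrite [LHS]tlift_tens; last exact: Lswap_bilinear.
have [tl tr] := tens_bilinear L F.
have [sl sr] := tens_bilinear E (tensor L F).
rewrite tlift_tens//; split=> [x' a y1 y2|y' a x1 x2]; last exact: sr.
by rewrite tl sl.
Qed.

Section diamond.
Variable dia : L -> L -> L.
Hypothesis bdia : bilinear_map dia.

Lemma Ldiamond_bilinear1 (xi : L) (x : E) :
  bilinear_map (fun eta (y : F) => tens (dia xi eta) (tens x y)).
Proof.
have [tl tr] := tens_bilinear E F.
have [sl sr] := tens_bilinear L (tensor E F).
split=> [eta a y y'|y a eta eta']; first by rewrite tl sl.
by rewrite bdia.1 sr.
Qed.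

Lemma Ldiamond_bilinear2 (v : tensor L F) : bilinear_map (fun xi (x : E) =>
  tlift (fun eta y => tens (dia xi eta) (tens x y)) v).
Proof.
have [tl tr] := tens_bilinear E F.
have [sl sr] := tens_bilinear L (tensor E F).
elim/tclass_ind: v => s; split=> [xi a x x'|x a xi xi'];
  rewrite !(tlift_class s (Ldiamond_bilinear1 _ _)) /formal_sum scaler_sumr;
  rewrite -big_split; apply: eq_bigr => z _ /=.
  by rewrite tr sl.
by rewrite bdia.2 sr.
Qed.

Lemma Ldiamond_bilinear : bilinear_map (@Ldiamond R L dia E F).
Proof.
split=> [u|v]; last exact: tlift_linear (Ldiamond_bilinear2 v).
move=> a v v'; move: u; elim/tclass_ind => s.
rewrite /Ldiamond !(tlift_class s (Ldiamond_bilinear2 _)) /formal_sum.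
rewrite scaler_sumr -big_split; apply: eq_bigr => z _ /=.
exact: (tlift_linear (Ldiamond_bilinear1 _ _)).
Qed.

Lemma Ldiamond_tens xi (x : E) eta (y : F) :
  Ldiamond dia (tens xi x) (tens eta y) = tens (dia xi eta) (tens x y).
Proof.
rewrite /Ldiamond (tlift_tens _ _ (Ldiamond_bilinear2 _)).
exact: tlift_tens (Ldiamond_bilinear1 _ _).
Qed.
End diamond.

End well_defined.

(* Main.v *)
Require Import Defs.
From HB Require Import structures.
From mathcomp Require Import all_boot all_order all_algebra.
From mathcomp Require Import all_classical all_reals all_analysis.
From mathcomp Require Import measurable_realfun ess_sup_inf.
From mathcomp Require Import complex.
From mathcomp Require Import ring.

Set Implicit Arguments.
Unset Strict Implicit.
Unset Printing Implicit Defensive.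

Import Order.TTheory GRing.Theory Num.Theory.
Import numFieldNormedType.Exports.
Import ComplexField.Normc.

Local Open Scope classical_set_scope.
Local Open Scope ring_scope.

(** Both norms of an element U of L(E (x) F) are infima of costs of
    representations, and each representation of one kind is turned into one of
    the other kind that is at most as expensive.

    From the diamond norm to the projective one: for u = xi x, the element
    a . (u <> v) becomes x (x) (a b) . v in E (x) LF, where b is the bounded
    operator eta |-> xi <> eta.  As || xi <> eta || <= || xi || || eta ||, the
    norm of b is at most || xi ||, and the L-norm of F absorbs the operators a
    and b.  Summing over a representation of u in L (x) E and taking the infimum
    gives || a || || u ||_max || v ||; this is [proj_norm_Lact_diamond].

    From the projective norm to the diamond one: it suffices to have a vector xi
    and an operator a with a (xi <> eta) = eta for all eta and
    || a || || xi || <= 1, for then U = sum_j x_j (x) v_j is rewritten as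
    sum_j a . (xi x_j <> v_j) without increasing the cost; this is
    [diamond_representation].  For L = L_p(X), take a set A of finite positive
    measure, let xi be its indicator, and let a undo the isometry i and then
    average over A in the first variable.  Fubini and Hoelder bound this
    averaging operator on L_p(X x X) by the inverse of || xi ||; this is
    [exists_Lprod_left_inverse]. *)

(** * Linear maps out of a tensor product *)

Section tensor_ext.
Context (K : fieldType) (V W Z : lmodType K).

(** Constructions such as [Lact] are functions with a separate proof of linearity;
    packing them gives access to the lemmas on linear maps. *)
Lemma linear_of (U : lmodType K) (f : U -> Z) : linear f ->
  exists g : {linear U -> Z}, g = f :> (U -> Z).
Proof.
move=> lf.
by exists (HB.pack_for {linear U -> Z} f (GRing.isLinear.Build K U Z *:%R f lf)).
Qed.

Lemma linear_big (U : lmodType K) (f : U -> Z) : linear f ->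
  forall (I : Type) (s : seq I) (g : I -> U),
  f (\sum_(j <- s) g j) = \sum_(j <- s) f (g j).
Proof. by move=> /linear_of[h <-] I s g; rewrite linear_sum. Qed.

Lemma tensor_ext (f g : tensor V W -> Z) : linear f -> linear g ->
  (forall x y, f (tens x y) = g (tens x y)) -> f =1 g.
Proof.
move=> lf lg fg; elim/tclass_ind => s; rewrite tclassE !linear_big//.
by apply: eq_bigr => x _; exact: fg.
Qed.

Lemma linear_compf (U : lmodType K) (f : W -> Z) (g : U -> W) :
  linear f -> linear g -> linear (fun x => f (g x)).
Proof. by move=> lf lg a x y; rewrite lg lf. Qed.

End tensor_ext.

(** * The projective tensor norm and the operator norm *)

Section norms.
Context (R : realType).

Section is_norm.
Context (V : lmodType R[i]) (N : V -> R).
Hypothesis Nn : is_norm N.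

Lemma is_norm0 : N 0 = 0.
Proof. by have [_ NZ _] := Nn; rewrite -(scale0r 0) NZ normc0 mul0r. Qed.

Lemma is_norm_ge0 v : 0 <= N v.
Proof.
have [ND NZ _] := Nn; have := ND v ((-1) *: v).
rewrite scaleN1r subrr is_norm0 -scaleN1r NZ.
have -> : normc (- 1 : R[i]) = 1 by rewrite normcN normc1.
by rewrite mul1r -mulr2n pmulrn_lge0.
Qed.

End is_norm.

(** Norms take complex values here, but they are real, so taking the real part
    loses nothing. *)
Lemma rnormE (V : normedModType R[i]) (x : V) : `|x| = (rnorm x)%:C%C.
Proof. by rewrite /rnorm RRe_real// ger0_real. Qed.

Lemma rnorm_is_norm (V : normedModType R[i]) : is_norm (@rnorm R V).
Proof.
split.
- by move=> u v; rewrite -lecR rmorphD/= -!rnormE ler_normD.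
- move=> a u; apply: complexI; rewrite rmorphM/= -!rnormE normrZ; congr (_ * _).
- by move=> u u0; apply/eqP; rewrite -normr_eq0 rnormE u0.
Qed.

Section proj_norm.
Context (V W : lmodType R[i]) (NV : V -> R) (NW : W -> R).
Hypotheses (NVn : is_norm NV) (NWn : is_norm NW).

Let cost (s : seq (V * W)) := \sum_(x <- s) NV x.1 * NW x.2.

Let cost_ge0 s : 0 <= cost s.
Proof. by apply: sumr_ge0 => x _; rewrite mulr_ge0// is_norm_ge0. Qed.

Lemma proj_norm_le (s : seq (V * W)) :
  proj_norm NV NW (\sum_(x <- s) tens x.1 x.2) <= \sum_(x <- s) NV x.1 * NW x.2.
Proof.
apply: ge_inf; last by exists s.
by exists 0 => _ [t _ <-]; exact: cost_ge0.
Qed.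

Lemma le_proj_norm (u : tensor V W) (c : R) :
  (forall s : seq (V * W), u = \sum_(x <- s) tens x.1 x.2 ->
    c <= \sum_(x <- s) NV x.1 * NW x.2) ->
  c <= proj_norm NV NW u.
Proof.
move=> H; apply: lb_le_inf; last by move=> _ [s us <-]; exact: H.
elim/tclass_ind: u H => s _; exists (cost s), s => //=.
by rewrite tclassE.
Qed.

Lemma proj_norm_ge0 u : 0 <= proj_norm NV NW u.
Proof. by apply: le_proj_norm => s _; exact: cost_ge0. Qed.

Lemma proj_norm0 : proj_norm NV NW 0 = 0.
Proof.
apply/eqP; rewrite eq_le proj_norm_ge0 andbT.
by have := proj_norm_le [::]; rewrite !big_nil.
Qed.

Lemma proj_normD u v :
  proj_norm NV NW (u + v) <= proj_norm NV NW u + proj_norm NV NW v.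
Proof.
rewrite -lerBlDr; apply: le_proj_norm => s us.
rewrite lerBlDr -lerBlDl; apply: le_proj_norm => t vt.
by rewrite lerBlDl us vt -!big_cat (le_trans (proj_norm_le _)).
Qed.

Lemma proj_norm_sum (I : Type) (s : seq I) (g : I -> tensor V W) :
  proj_norm NV NW (\sum_(j <- s) g j) <= \sum_(j <- s) proj_norm NV NW (g j).
Proof.
elim: s => [|j s IH]; first by rewrite !big_nil proj_norm0.
by rewrite !big_cons (le_trans (proj_normD _ _))// lerD2l.
Qed.

Lemma proj_norm_tens x y : proj_norm NV NW (tens x y) <= NV x * NW y.
Proof. by have := proj_norm_le [:: (x, y)]; rewrite !big_seq1. Qed.

End proj_norm.

Section opnorm.
Context (L : normedModType R[i]).

Let unit_has_sup (a : bounded_op L) :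
  has_sup [set rnorm (a xi) | xi in [set xi : L | rnorm xi <= 1]].
Proof.
have r0 := is_norm0 (rnorm_is_norm L).
split; first by exists (rnorm (a 0)), 0 => //=; rewrite r0.
case: a => a [M aM]; exists (Num.max 0 M) => _ [xi /= xi1 <-].
rewrite (le_trans (aM _))//.
have xi0 := is_norm_ge0 (rnorm_is_norm L) xi.
rewrite (le_trans (ler_wpM2r xi0 (_ : M <= Num.max 0 M)))//.
  by rewrite le_max lexx orbT.
by rewrite ler_piMr// le_max lexx.
Qed.

Lemma opnorm_ge0 (a : bounded_op L) : 0 <= opnorm a.
Proof.
apply: sup_upper_bound (unit_has_sup a) _ _; exists 0 => /=.
  by rewrite (is_norm0 (rnorm_is_norm L)).
by rewrite linear0 (is_norm0 (rnorm_is_norm L)).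
Qed.

Lemma opnorm_le (a : bounded_op L) (M : R) : 0 <= M ->
  (forall xi, rnorm (a xi) <= M * rnorm xi) -> opnorm a <= M.
Proof.
move=> M0 aM; apply: sup_le_ub; first exact: (unit_has_sup a).1.
by move=> _ [xi /= xi1 <-]; rewrite (le_trans (aM _))// ler_piMr.
Qed.

End opnorm.
End norms.

(** * Comparison of the two norms for an abstract diamond operation *)

Section max_tensor.
Context (R : realType) (L : normedModType R[i]) (dia : L -> L -> L).
Hypothesis dia_bilinear : bilinear_map dia.
Hypothesis dia_le : forall xi eta, rnorm (dia xi eta) <= rnorm xi * rnorm eta.
Context (E : normedModType R[i]) (F : Ldata L).
Hypothesis FL : is_Lspace F.

Local Notation NE := (@rnorm R E).
Local Notation NL := (@rnorm R L).
Local Notation NF := (@Lnrm R L F).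
Let NEn : is_norm NE := rnorm_is_norm E.
Let NLn : is_norm NL := rnorm_is_norm L.
Let NFn : is_norm NF := FL.1.

Lemma dia_op (xi : L) : exists a : bounded_op L,
  (forall eta, a eta = dia xi eta) /\ opnorm a <= rnorm xi.
Proof.
have [f fE] := linear_of (dia_bilinear.1 xi).
have fle eta : rnorm (f eta) <= rnorm xi * rnorm eta by rewrite fE dia_le.
have fb : exists M : R, forall eta, rnorm (f eta) <= M * rnorm eta.
  by exists (rnorm xi).
exists (BoundedOp fb); split; first by move=> eta /=; rewrite fE.
by apply: opnorm_le => //; exact: is_norm_ge0.
Qed.

(** For u = xi x, taking the diamond with u acts on v only through the operator
    eta |-> xi <> eta, so that x can be pulled out as a tensor factor.  This is
    what makes the module inequality of F applicable. *)
Lemma Lswap_Lact_diamond (a : bounded_op L) (xi : L) (x : E) (v : tensor L F)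
    (b : bounded_op L) : (forall eta, b eta = dia xi eta) ->
  Lswap (Lact a (Ldiamond dia (tens xi x) v)) = tens x (Lact a (Lact b v)).
Proof.
move=> bE; move: v.
have [tl _] := tens_bilinear E (tensor L F).
apply: tensor_ext => [||eta y].
- do 2![apply: linear_compf; first by [exact: Lswap_linear|exact: Lact_linear]].
  exact: (Ldiamond_bilinear E F dia_bilinear).1.
- apply: linear_compf; first exact: tl.
  by apply: linear_compf; exact: Lact_linear.
- by rewrite Ldiamond_tens// !Lact_tens Lswap_tens bE.
Qed.

(** A single term of a diamond representation costs at least as much as its image
    in E (x) LF: expand u over L (x) E and let the L-norm of F absorb a and the
    operators eta |-> xi <> eta. *)
Lemma proj_norm_Lact_diamond (a : bounded_op L) (u : tensor L E) (v : tensor L F) :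
  proj_norm NE NF (Lswap (Lact a (Ldiamond dia u v))) <=
  opnorm a * proj_norm NL NE u * NF v.
Proof.
have a0 := opnorm_ge0 a; have v0 := is_norm_ge0 NFn v.
have c0 : 0 <= opnorm a * NF v by exact: mulr_ge0.
have bound s : u = \sum_(x <- s) tens x.1 x.2 ->
    proj_norm NE NF (Lswap (Lact a (Ldiamond dia u v))) <=
    opnorm a * NF v * \sum_(x <- s) NL x.1 * NE x.2.
  move=> ->.
  rewrite (linear_big ((Ldiamond_bilinear E F dia_bilinear).2 v)).
  rewrite (linear_big (@Lact_linear _ _ _ a)) (linear_big (@Lswap_linear _ _ _ _)).
  rewrite (le_trans (proj_norm_sum NEn NFn _ _))// mulr_sumr ler_sum// => -[xi x] _.
  have [b [bE bxi]] := dia_op xi.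
  rewrite (Lswap_Lact_diamond _ _ _ bE) (le_trans (proj_norm_tens NEn NFn _ _))//=.
  rewrite mulrA mulrC ler_wpM2r ?is_norm_ge0//.
  rewrite (le_trans (FL.2 _ _))// -mulrA ler_wpM2l//.
  by rewrite (le_trans (FL.2 _ _))// mulrC ler_wpM2l.
rewrite mulrAC.
(* Passing to the infimum over the representations of u means dividing by
   opnorm a * NF v, so the case where this vanishes is separate. *)
have [c_eq0|c_neq0] := eqVneq (opnorm a * NF v) 0.
  elim/tclass_ind: u bound => s /(_ s (tclassE _)).
  by rewrite c_eq0 !mul0r.
have c_gt0 : 0 < opnorm a * NF v by rewrite lt_neqAle eq_sym c_neq0.
rewrite mulrC -ler_pdivrMr//; apply: le_proj_norm => // s us.
by rewrite ler_pdivrMr// mulrC bound.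
Qed.

Context (xi : L) (a : bounded_op L).
Hypothesis a_xi : forall eta, a (dia xi eta) = eta.
Hypothesis a_xi_le1 : opnorm a * rnorm xi <= 1.

Lemma Lswap_inv_bilinear : bilinear_map (fun (x : E) (v : tensor L F) =>
  Lact a (Ldiamond dia (tens xi x) v)).
Proof.
have [bl br] := Ldiamond_bilinear E F dia_bilinear.
have [tl tr] := tens_bilinear L E.
split=> [x|v].
  by apply: linear_compf; [exact: Lact_linear|exact: bl].
apply: linear_compf; first exact: Lact_linear.
by apply: (linear_compf (br v)); exact: tl.
Qed.

(** Besides inverting [Lswap], this expresses every U directly through elements
    a . (xi x <> v), which is what a diamond representation consists of. *)
Lemma Lswap_inv (U : tensor L (tensor E F)) :
  tlift (fun (x : E) (v : tensor L F) => Lact a (Ldiamond dia (tens xi x) v))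
    (Lswap U) = U.
Proof.
have lG := tlift_linear Lswap_inv_bilinear.
move: U; apply: (@tensor_ext _ _ _ _ _ id) => // [|eta z].
  by apply: linear_compf; [exact: lG|exact: Lswap_linear].
have [tl tr] := tens_bilinear L (tensor E F).
move: z; apply: tensor_ext => [||x y].
- apply: linear_compf; first exact: lG.
  by apply: linear_compf; [exact: Lswap_linear|exact: tl].
- exact: tl.
- rewrite Lswap_tens tlift_tens; last exact: Lswap_inv_bilinear.
  by rewrite Ldiamond_tens// Lact_tens a_xi.
Qed.

(** Replacing x (x) v by a . (xi x <> v) multiplies the cost by at most
    || a || || xi || <= 1. *)
Lemma diamond_representation (U : tensor L (tensor E F)) (s : seq (E * tensor L F)) :
  Lswap U = \sum_(x <- s) tens x.1 x.2 ->
  exists t : seq (bounded_op L * tensor L E * tensor L F),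
    U = \sum_(c <- t) Lact c.1.1 (Ldiamond dia c.1.2 c.2) /\
    \sum_(c <- t) opnorm c.1.1 * proj_norm NL NE c.1.2 * NF c.2 <=
    \sum_(x <- s) NE x.1 * NF x.2.
Proof.
move=> Us; exists [seq (a, tens xi x.1, x.2) | x <- s]; split.
  rewrite -[LHS]Lswap_inv Us (linear_big (tlift_linear Lswap_inv_bilinear)).
  rewrite big_map; apply: eq_bigr => x _.
  by rewrite tlift_tens//; exact: Lswap_inv_bilinear.
rewrite big_map ler_sum// => -[x v] _ /=.
rewrite ler_wpM2r ?(is_norm_ge0 NFn)//.
rewrite (le_trans (ler_wpM2l (opnorm_ge0 a) (proj_norm_tens NLn NEn _ _)))//.
by rewrite mulrA ler_piMl// is_norm_ge0.
Qed.

Lemma Lnrm_Ltensor_Lmax (U : tensor L (tensor E F)) :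
  @Lnrm _ _ (Ltensor dia (Lmax L E) F) U = @Lnrm _ _ (Lpr E F) U.
Proof.
have cost_ge0 (t : seq (bounded_op L * tensor L E * tensor L F)) :
    0 <= \sum_(c <- t) opnorm c.1.1 * proj_norm NL NE c.1.2 * NF c.2.
  apply: sumr_ge0 => c _; rewrite !mulr_ge0 ?opnorm_ge0 ?(is_norm_ge0 NFn)//.
  exact: proj_norm_ge0.
apply/eqP; rewrite eq_le; apply/andP; split.
  apply: le_proj_norm => // s /diamond_representation[t [Ut ts]].
  apply: le_trans ts; apply: ge_inf; last by exists t.
  by exists 0 => _ [t' _ <-]; exact: cost_ge0.
apply: lb_le_inf.
  have [s Us] : exists s : seq (E * tensor L F), Lswap U = \sum_(x <- s) tens x.1 x.2.
    by elim/tclass_ind: (Lswap U) => s; exists s; rewrite tclassE.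
  by have [t [Ut _]] := diamond_representation Us; eexists; exists t.
move=> _ [t Ut <-]; rewrite /= Ut (linear_big (@Lswap_linear _ _ _ _)).
rewrite (le_trans (proj_norm_sum NEn NFn _ _))// ler_sum// => c _.
exact: proj_norm_Lact_diamond.
Qed.

Lemma L_isometric_id :
  L_isometric_iso (idfun : {linear Ltensor dia (Lmax L E) F -> Lpr E F}).
Proof.
have ampE : amplification (idfun : {linear tensor E F -> tensor E F}) =1
    (id : tensor L (tensor E F) -> _).
  apply: tensor_ext => // [|eta z]; first exact: amplification_linear.
  by rewrite amplification_tens.
split; first by exists id => U; rewrite /= ampE.
by move=> U; rewrite ampE Lnrm_Ltensor_Lmax.
Qed.

End max_tensor.

(** * The modulus of a complex number *)

Section modulus_lemmas.
Context (R : realType).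

Lemma normc_ge_abs (z : R[i]) : `|complex.Re z| <= normc z /\ `|complex.Im z| <= normc z.
Proof.
case: z => a b /=; split; rewrite -sqrtr_sqr ler_sqrt ?addr_ge0 ?sqr_ge0//.
  by rewrite lerDl sqr_ge0.
by rewrite lerDr sqr_ge0.
Qed.

Lemma normc_cauchy_schwarz (z w : R[i]) :
  `|complex.Re z * complex.Re w + complex.Im z * complex.Im w| <= normc z * normc w.
Proof.
case: z w => [a b] [c e] /=.
rewrite -sqrtrM ?addr_ge0 ?sqr_ge0//.
rewrite -sqrtr_sqr ler_sqrt ?mulr_ge0 ?addr_ge0 ?sqr_ge0//.
rewrite -subr_ge0 (_ : _ - _ = (a * e - b * c) ^+ 2) ?sqr_ge0//.
by ring.
Qed.

End modulus_lemmas.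

(** * Mixed norms of functions on a product space *)

Section slices.
Context d (X : measurableType d) (R : realType).
Variable mu : {sigma_finite_measure set X -> \bar R}.
Variables (p : \bar R) (p1 : (1 <= p)%E).
Local Notation mu2 := (mu \x mu)%E.

Let measurable_powabs d' (T : measurableType d') (r : R) (h : T -> R) :
  measurable_fun setT h ->
  measurable_fun setT (fun x : T => (`|(EFin \o h) x| `^ r)%E).
Proof.
move=> mh; apply/measurable_EFinP; apply: (measurableT_comp (measurable_powR _)).
exact: measurableT_comp.
Qed.

Let measurable_slice (h : X * X -> R) t :
  measurable_fun setT h -> measurable_fun setT (fun s => h (s, t)).
Proof. by move=> mh; apply: measurableT_comp. Qed.

(** The null-set half of Fubini's theorem: the measures of the slices of a null
    set integrate to zero. *)
Lemma ae_slice (P : X * X -> Prop) : (\forall z \ae mu2, P z) ->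
  \forall t \ae mu, \forall s \ae mu, P (s, t).
Proof.
move=> [N [mN N0 PN]].
have : (\int[mu]_t \int[mu]_s (\1_N (s, t))%:E = 0)%E.
  rewrite -(fubini_tonelli2 (EFin \o \1_N)).
  - by rewrite integral_indic// setIT.
  - by apply/measurable_EFinP.
  - by move=> z; rewrite lee_fin.
have mG : measurable_fun setT (fun t : X => \int[mu]_s (\1_N (s, t))%:E)%E.
  apply: (measurable_fun_fubini_tonelli_G (EFin \o \1_N)).
  - exact/measurable_EFinP.
  - by move=> z; rewrite lee_fin.
have G0 t : (0 <= \int[mu]_s (\1_N (s, t))%:E)%E.
  by apply: integral_ge0 => s _; rewrite lee_fin.
rewrite (eq_integral (fun t => `|\int[mu]_s (\1_N (s, t))%:E|)%E); last first.
  by move=> t _; rewrite gee0_abs.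
move=> /(ae_eq_integral_abs mu measurableT mG); apply: filterS => t /(_ I) /= Nt0.
exists (ysection N t); split; first exact: measurable_ysection.
  rewrite -[ysection N t]setIT -integral_indic//; last exact: measurable_ysection.
  rewrite -[RHS]Nt0; apply: eq_integral => s _.
  by rewrite !indicE mem_ysection.
by move=> s /= nP; rewrite /ysection/= inE; exact: PN.
Qed.

Lemma Lnorm_slice_tonelli (h : X * X -> R) (r : R) : 0 < r -> measurable_fun setT h ->
  (\int[mu2]_z `|(h z)%:E| `^ r =
   \int[mu]_t ('N[mu]_r%:E[EFin \o (fun s => h (s, t))] `^ r))%E.
Proof.
move=> r0 mh; rewrite (fubini_tonelli2 (fun z => `|(h z)%:E| `^ r)%E).
- by apply: eq_integral => t _; rewrite poweR_Lnorm ?gt_eqF.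
- exact: measurable_powabs.
- by move=> z; exact: poweR_ge0.
Qed.

Lemma measurable_slice_Lnorm_pow (h : X * X -> R) (r : R) : 0 < r ->
  measurable_fun setT h -> measurable_fun setT
  (fun t : X => ('N[mu]_r%:E[EFin \o (fun s => h (s, t))] `^ r)%E).
Proof.
move=> r0 mh.
rewrite (_ : (fun _ => _) = (fun t => \int[mu]_s (`|(h (s, t))%:E| `^ r))%E).
  apply: (measurable_fun_fubini_tonelli_G (fun z => `|(h z)%:E| `^ r)%E).
  - exact: measurable_powabs.
  - by move=> z; exact: poweR_ge0.
by apply/funext => t; rewrite poweR_Lnorm ?gt_eqF.
Qed.

Hypothesis mu_gt0 : (0 < mu setT)%E.

Lemma product_measure_gt0 : (0 < mu2 setT)%E.
Proof. by rewrite -setXTT product_measure1E// mule_gt0. Qed.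

Lemma slice_Lnormy_le (h : X * X -> R) : measurable_fun setT h ->
  \forall t \ae mu, ('N[mu]_+oo[EFin \o (fun s => h (s, t))] <=
    'N[mu2]_+oo[EFin \o h])%E.
Proof.
move=> mh; rewrite unlock mu_gt0 product_measure_gt0.
have /ae_slice := ess_sup_ge mu2 (abse \o (EFin \o h)).
by apply: filterS => t ht; exact/ess_supP.
Qed.

Lemma slice_Lnorm_lty (h : X * X -> R) : measurable_fun setT h ->
  finite_norm mu2 p h ->
  \forall t \ae mu, ('N[mu]_p[EFin \o (fun s => h (s, t))] < +oo)%E.
Proof.
case: p p1 => [r r1|_|//] mh; last first.
  move=> hfin; apply: filterS (slice_Lnormy_le mh) => t /le_lt_trans; exact.
have r0 : 0 < r by rewrite (lt_le_trans ltr01)// -lee_fin.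
have mN := measurable_slice_Lnorm_pow r0 mh.
rewrite /finite_norm [in X in X -> _]unlock => /lty_poweRy.
rewrite invr_eq0 gt_eqF// => /(_ isT); rewrite [X in (X < _)%E]Lnorm_slice_tonelli// => Nfin.
have : mu.-integrable setT
    (fun t => 'N[mu]_r%:E[EFin \o (fun s => h (s, t))] `^ r)%E.
  apply/integrableP; split => //.
  by under eq_integral do rewrite gee0_abs ?poweR_ge0//.
move=> /(integrable_ae measurableT); apply: filterS => t /(_ I).
rewrite ge0_fin_numE ?poweR_ge0// => /lty_poweRy; apply.
by rewrite gt_eqF.
Qed.

(** Taking the L_p-norm in the first variable and then in the second one gives at
    most the L_p-norm on the product.  The mixed norm is replaced by a measurable
    function k below it, which avoids asking whether the norms of the slices
    depend measurably on t when p is infinite. *)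
Lemma Lnorm_le_slice (h : X * X -> R) (k : X -> R) (c : R) :
  measurable_fun setT h -> measurable_fun setT k -> 0 <= c ->
  (\forall t \ae mu,
    (`|k t|%:E <= c%:E * 'N[mu]_p[EFin \o (fun s => h (s, t))])%E) ->
  ('N[mu]_p[EFin \o k] <= c%:E * 'N[mu2]_p[EFin \o h])%E.
Proof.
case: p p1 => [r r1|_|//] mh mk c0 kh; last first.
  rewrite {1}unlock mu_gt0; apply/ess_supP.
  near=> t.
  apply: (@le_trans _ _ (c%:E * 'N[mu]_+oo[EFin \o (fun s => h (s, t))])%E).
    by near: t.
  by rewrite lee_wpmul2l ?lee_fin//; near: t; exact: slice_Lnormy_le.
have r0 : 0 < r by rewrite (lt_le_trans ltr01)// -lee_fin.
have mN := measurable_slice_Lnorm_pow r0 mh.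
have N0 g : (0 <= 'N[mu2]_r%:E[g])%E by exact: Lnorm_ge0.

have cN0 : (0 <= c%:E * 'N[mu2]_r%:E[EFin \o h])%E by rewrite mule_ge0.
(* compare the r-th powers, which are integrals *)
rewrite -[leRHS]poweRe1// -(@mulfV _ r) ?gt_eqF// poweRrM {1}unlock.
apply: gt0_ler_poweR.
- by rewrite invr_ge0 ltW.
- by rewrite in_itv/= leey andbT integral_ge0// => x _; exact: poweR_ge0.
- by rewrite in_itv/= leey andbT poweR_ge0.
rewrite poweRM ?lee_fin// poweR_Lnorm ?gt_eqF// Lnorm_slice_tonelli//.
rewrite -ge0_integralZl//; [|by move=> t _; exact: poweR_ge0|exact: poweR_ge0].
apply: ae_ge0_le_integral => //.
- by move=> t _; exact: poweR_ge0.
- exact: measurable_powabs.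
- by move=> t _; rewrite mule_ge0 ?poweR_ge0.
- exact: measurable_funeM.
apply: filterS kh => t kh _.
have Nt0 : (0 <= 'N[mu]_r%:E[EFin \o (fun s => h (s, t))])%E := Lnorm_ge0 _ _ _.
rewrite -poweRM ?lee_fin//.
apply: gt0_ler_poweR => //; [exact: ltW|by rewrite in_itv/= leey andbT|].
by rewrite in_itv/= leey andbT mule_ge0 ?lee_fin.
Unshelve. all: by end_near. Qed.

Lemma Lnorm_prod_le (f g : X -> R) : measurable_fun setT f -> measurable_fun setT g ->
  ('N[mu2]_p[EFin \o (fun z => f z.1 * g z.2)%R] <=
   'N[mu]_p[EFin \o f] * 'N[mu]_p[EFin \o g])%E.
Proof.
case: p p1 => [r r1|_|//] mf mg; last first.
  rewrite unlock mu_gt0 product_measure_gt0; apply/ess_supP.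
  have /ae_prod1 h1 := ess_sup_ge mu (abse \o (EFin \o f)).
  have /ae_prod2 h2 := ess_sup_ge mu (abse \o (EFin \o g)).
  near=> z; rewrite /= normrM EFinM.
  by apply: lee_pmul => //; near: z.
have r0 : 0 < r by rewrite (lt_le_trans ltr01)// -lee_fin.
have I0 (h : X -> R) : (0 <= \int[mu]_x (`|(h x)%:E| `^ r))%E.
  by apply: integral_ge0 => x _; exact: poweR_ge0.
have mfg : measurable_fun setT (fun z : X * X => f z.1 * g z.2).
  by apply: measurable_funM; exact: measurableT_comp.
rewrite unlock -poweRM; [|exact: I0..].
apply: gt0_ler_poweR.
- by rewrite invr_ge0 ltW.
- by rewrite in_itv/= leey andbT integral_ge0// => x _; exact: poweR_ge0.
- by rewrite in_itv/= leey andbT mule_ge0//; exact: I0.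
have pow0 (x : \bar R) : (0 <= x `^ r)%E by exact: poweR_ge0.
rewrite (fubini_tonelli1 (fun z => `|(f z.1 * g z.2)%R%:E| `^ r)%E)//; last first.
  exact: measurable_powabs.
rewrite -ge0_integralZr//; [|exact: measurable_powabs|exact: I0].
rewrite le_eqVlt; apply/orP; left; apply/eqP; apply: eq_integral => x _.
rewrite /fubini_F -ge0_integralZl//; last exact: measurable_powabs.
by apply: eq_integral => y _; rewrite /= normrM powRM.
Unshelve. all: by end_near. Qed.

Lemma lpnorm_lpprod (f g : lpfun mu p1) : lpnorm (lpprod f g) <= lpnorm f * lpnorm g.
Proof.
have [[mf _] [mg _]] := (lpfunP f, lpfunP g).
rewrite -lee_fin EFinM !lpnormE.
have := Lnorm_prod_le (cmeasurable_normc mf) (cmeasurable_normc mg).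
apply: le_trans; rewrite le_eqVlt; apply/orP; left; apply/eqP.
by apply: eq_Lnorm => z; rewrite /= /modulus normcM.
Qed.

(** * Integration against a kernel in the first variable *)

(** [psi] represents a functional on L_p of norm at most [C]; bounding the integral
    of the absolute value also yields integrability. *)
Variables (psi : X -> R) (C : R).
Hypotheses (mpsi : measurable_fun setT psi) (C0 : 0 <= C).
Hypothesis psi_dual : forall k : X -> R, measurable_fun setT k ->
  (\int[mu]_s `|k s * psi s|%R%:E <= C%:E * 'N[mu]_p[EFin \o k])%E.

Lemma pairing_integrable (k : X -> R) : measurable_fun setT k ->
  ('N[mu]_p[EFin \o k] < +oo)%E ->
  mu.-integrable setT (EFin \o (fun s => k s * psi s)).
Proof.
move=> mk kfin; apply/integrableP; split.
  by apply/measurable_EFinP; exact: measurable_funM.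
by rewrite (le_lt_trans (psi_dual mk))// lte_mul_pinfty// lee_fin.
Qed.

(** Meaningful only when [k] times [psi] is integrable, in particular for [k] in
    L_p; otherwise the value is a default one. *)
Definition pairing (k : X -> R) : R := \int[mu]_s (k s * psi s).

Lemma measurable_pairing (h : X * X -> R) : measurable_fun setT h ->
  measurable_fun setT (fun t => pairing (fun s => h (s, t))).
Proof.
move=> mh; apply: (measurableT_comp (fine_measurable measurableT)).
pose H (z : X * X) : \bar R := (h z * psi z.1)%:E.
have mH : measurable_fun setT H.
  apply/measurable_EFinP; apply: measurable_funM => //.
  exact: measurableT_comp.
rewrite (_ : (fun _ => _) = (fun t => \int[mu]_s H^\+ (s, t)) \-
    (fun t => \int[mu]_s H^\- (s, t)))%E; last first.
  apply/funext => t; rewrite integralE; congr (_ - _)%E; apply: eq_integral => s _.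
    by rewrite !funeposE.
  by rewrite !funenegE.
apply: emeasurable_funB.
  apply: (measurable_fun_fubini_tonelli_G (H^\+)%E); first exact: measurable_funepos.
  by move=> z; exact: funepos_ge0.
apply: (measurable_fun_fubini_tonelli_G (H^\-)%E); first exact: measurable_funeneg.
by move=> z; exact: funeneg_ge0.
Qed.

Definition cpairing (k : X -> R[i]) : R[i] :=
  (pairing (fun s => complex.Re (k s)) +i* pairing (fun s => complex.Im (k s)))%C.

Lemma cpairing_integrable (k : X -> R[i]) : cmeasurable k ->
  finite_norm mu p (modulus k) ->
  mu.-integrable setT (EFin \o (fun s => complex.Re (k s) * psi s)) /\
  mu.-integrable setT (EFin \o (fun s => complex.Im (k s) * psi s)).
Proof.
move=> mk kfin; have int := pairing_integrable (cmeasurable_normc mk) kfin.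
split; apply: le_integrable int => //.
- by apply/measurable_EFinP; apply: measurable_funM => //; exact: mk.1.
- move=> s _; rewrite /= lee_fin !normrM ler_wpM2r// /modulus.
  by rewrite (ger0_norm (normc_ge0 _)) (normc_ge_abs _).1.
- by apply/measurable_EFinP; apply: measurable_funM => //; exact: mk.2.
- move=> s _; rewrite /= lee_fin !normrM ler_wpM2r// /modulus.
  by rewrite (ger0_norm (normc_ge0 _)) (normc_ge_abs _).2.
Qed.

Let integrableZR (c : R) (k : X -> R) : mu.-integrable setT (EFin \o k) ->
  mu.-integrable setT (EFin \o (fun s => c * k s)).
Proof. exact: integrableZl. Qed.

(** The classical rotation argument: the squared modulus of z = int k psi is the
    integral of the real inner product of z with k psi, hence at most
    | z | int | k psi |. *)
Lemma cpairing_le (k : X -> R[i]) : cmeasurable k ->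
  finite_norm mu p (modulus k) ->
  ((normc (cpairing k))%:E <= C%:E * 'N[mu]_p[EFin \o modulus k])%E.
Proof.
move=> mk kfin; have [iu iv] := cpairing_integrable mk kfin.
have mmk := cmeasurable_normc mk; have int := pairing_integrable mmk kfin.
apply: le_trans (psi_dual mmk).
pose w s := `|modulus k s * psi s|.
have iw : mu.-integrable setT (EFin \o w) by exact: integrable_abse int.
rewrite -[leRHS](fineK (integrable_fin_num measurableT iw)) lee_fin.
rewrite -[leRHS]/(\int[mu]_s w s).
set z := cpairing k.
have [z0|z0] := eqVneq (normc z) 0.
  by rewrite z0 Rintegral_ge0// => s _; exact: normr_ge0.
have {}z0 : 0 < normc z by rewrite lt_neqAle eq_sym z0 normc_ge0.
rewrite -(ler_pM2l z0) -RintegralZl//.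
have -> : normc z * normc z = \int[mu]_s (complex.Re z * (complex.Re (k s) * psi s)
    + complex.Im z * (complex.Im (k s) * psi s)).
  rewrite RintegralD//; last 2 first.
  - exact: integrableZR.
  - exact: integrableZR.
  rewrite !RintegralZl//.
  have -> : normc z * normc z = complex.Re z ^+ 2 + complex.Im z ^+ 2.
    by rewrite -expr2; case: (z) => a b; rewrite sqr_sqrtr// addr_ge0// sqr_ge0.
  by rewrite !expr2.
apply: le_Rintegral => //.
- exact: (integrableD measurableT (integrableZR (complex.Re z) iu)
    (integrableZR (complex.Im z) iv)).
- exact: integrableZR.
- move=> s _; rewrite !mulrA -mulrDl (le_trans (ler_norm _))// normrM.
  rewrite /w normrM mulrA ler_wpM2r//.
  by rewrite (ger0_norm (normc_ge0 _)) normc_cauchy_schwarz.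
Qed.

Lemma cpairing_linear (a : R[i]) (k l : X -> R[i]) :
  cmeasurable k -> finite_norm mu p (modulus k) ->
  cmeasurable l -> finite_norm mu p (modulus l) ->
  cpairing (a *: k + l) = a * cpairing k + cpairing l.
Proof.
move=> mk fk ml fl.
have [iu iv] := cpairing_integrable mk fk.
have [iu' iv'] := cpairing_integrable ml fl.
case: a => a b; rewrite /cpairing/=.
rewrite -[RHS]/((a * _ - b * _ + _) +i* (a * _ + b * _ + _))%C.
congr (_ +i* _)%C; rewrite /pairing -!RintegralZl//.
- rewrite -RintegralB//; [|exact: integrableZR..].
  rewrite -RintegralD//; last first.
    exact: (integrableB measurableT (integrableZR a iu) (integrableZR b iv)).
  apply: eq_Rintegral => s _.
  rewrite -[(_ + _) s]/(((a +i* b)%C * k s) + l s).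
  by case: (k s) => ? ?; case: (l s) => ? ? /=; ring.
- rewrite -RintegralD//; [|exact: integrableZR..].
  rewrite -RintegralD//; last first.
    exact: (integrableD measurableT (integrableZR a iv) (integrableZR b iu)).
  apply: eq_Rintegral => s _.
  rewrite -[(_ + _) s]/(((a +i* b)%C * k s) + l s).
  by case: (k s) => ? ?; case: (l s) => ? ? /=; ring.
Qed.

Lemma pairing0 : pairing (fun=> 0) = 0.
Proof.
rewrite /pairing -[RHS](mul0r (fine (mu setT))) -(@Rintegral_cst _ _ _ mu)//.
by apply: eq_Rintegral => s _; rewrite mul0r.
Qed.

Lemma cpairing_real (k : X -> R) :
  cpairing (fun s => (k s)%:C%C) = (pairing k)%:C%C.
Proof. by rewrite /cpairing /= pairing0. Qed.

Lemma cpairing0 : cpairing 0 = 0.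
Proof. by rewrite [LHS](cpairing_real (fun=> 0)) pairing0. Qed.

Definition slice (g : X * X -> R[i]) : X -> R[i] :=
  fun t => cpairing (fun s => g (s, t)).

Let cmeasurable_section (g : X * X -> R[i]) t :
  cmeasurable g -> cmeasurable (fun s => g (s, t)).
Proof. by move=> [mr mi]; split; [exact: measurable_slice mr|exact: measurable_slice mi]. Qed.

Lemma cmeasurable_slice (g : X * X -> R[i]) : cmeasurable g -> cmeasurable (slice g).
Proof. by move=> [mr mi]; split; [exact: measurable_pairing mr|exact: measurable_pairing mi]. Qed.

Lemma Lnorm_slice_le (g : X * X -> R[i]) : cmeasurable g ->
  finite_norm mu2 p (modulus g) ->
  ('N[mu]_p[EFin \o modulus (slice g)] <= C%:E * 'N[mu2]_p[EFin \o modulus g])%E.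
Proof.
move=> mg gfin; apply: Lnorm_le_slice => //.
- exact: cmeasurable_normc.
- exact/cmeasurable_normc/cmeasurable_slice.
apply: filterS (slice_Lnorm_lty (cmeasurable_normc mg) gfin) => t tfin.
rewrite ger0_norm ?normc_ge0//.
exact: (cpairing_le (cmeasurable_section t mg)).
Qed.

Lemma slice_LpFun (g : lpfun mu2 p1) : slice g \in LpFun mu p1.
Proof.
have [mg gfin] := lpfunP g; rewrite inE; split; first exact: cmeasurable_slice.
apply: (le_lt_trans (Lnorm_slice_le mg gfin)).
by rewrite lte_mul_pinfty// lee_fin.
Qed.

Definition lpslice (g : lpfun mu2 p1) : lpfun mu p1 := LpFunction (slice_LpFun g).

Lemma lpnorm_lpslice g : lpnorm (lpslice g) <= C * lpnorm g.
Proof.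
have [mg gfin] := lpfunP g.
by rewrite -lee_fin EFinM !lpnormE; exact: Lnorm_slice_le.
Qed.

Lemma lpslice_linear a (f g : lpfun mu2 p1) :
  Lclass (lpslice (a *: f + g)) = a *: Lclass (lpslice f) + Lclass (lpslice g).
Proof.
have [[mf ffin] [mg gfin]] := (lpfunP f, lpfunP g).
rewrite -LclassZ -LclassD; apply/Lclass_eq.
have hf := slice_Lnorm_lty (cmeasurable_normc mf) ffin.
have hg := slice_Lnorm_lty (cmeasurable_normc mg) gfin.
near=> t.
have -> : lpslice (a *: f + g) t =
    cpairing (a *: (fun s => f (s, t)) + (fun s => g (s, t))) by [].
rewrite cpairing_linear//.
- exact: (cmeasurable_section t mf).
- by near: t; exact: hf.
- exact: (cmeasurable_section t mg).
- by near: t; exact: hg.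
Unshelve. all: by end_near. Qed.

Definition Lslice (xi : Lp mu2 p1) : Lp mu p1 := Lclass (lpslice (repr xi)).

(** Equality almost everywhere is respected because the operator is bounded:
    the difference of two representatives has norm 0, and so does its image. *)
Lemma LsliceE f : Lslice (Lclass f) = Lclass (lpslice f).
Proof.
rewrite /Lslice; set f' := repr _.
apply/eqP; rewrite -subr_eq0 -scaleN1r addrC -lpslice_linear; apply/eqP/lpnorm_eq0.
apply/eqP; rewrite eq_le; apply/andP; split; last first.
  by rewrite -lee_fin lpnormE; exact: Lnorm_ge0.
rewrite (le_trans (lpnorm_lpslice _))//.
rewrite (_ : lpnorm _ = 0) ?mulr0//.
rewrite (@lpnorm_ae _ _ _ _ _ _ _ 0).
  by rewrite -[0 in LHS](scale0r 0) lpnormZ normc0 mul0r.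
apply: filterS (Lrepr_ae f) => z fz.
by rewrite -[LHS]/(-1 * f z + f' z) /f' fz mulN1r addNr.
Qed.

Lemma Lslice_linear : linear Lslice.
Proof.
move=> a; elim/Lclass_ind => f; elim/Lclass_ind => g.
by rewrite -LclassZ -LclassD !LsliceE lpslice_linear.
Qed.

Lemma rnorm_Lclass d' (T : measurableType d') (nu : {measure set T -> \bar R})
  (f : lpfun nu p1) : rnorm (Lclass f) = lpnorm f.
Proof. by rewrite /rnorm -[`|_|]/(Lpnorm _) LpnormE. Qed.

Lemma rnorm_Lslice xi : rnorm (Lslice xi) <= C * rnorm xi.
Proof. by elim/Lclass_ind: xi => f; rewrite LsliceE !rnorm_Lclass lpnorm_lpslice. Qed.

Lemma Lslice_Lprod (f : lpfun mu p1) eta :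
  Lslice (Lprod (Lclass f) eta) = cpairing f *: eta.
Proof.
elim/Lclass_ind: eta => g; rewrite LprodE LsliceE -LclassZ; apply/Lclass_eq.
apply: nearW => t.
rewrite -[LHS]/(cpairing (fun s => f s * g t)) -[RHS]/(cpairing f * g t).
have [mf ffin] := lpfunP f.
have [m0 fin0] := lpfunP (0 : lpfun mu p1).
rewrite (_ : (fun s => f s * g t) = g t *: (f : X -> R[i]) + 0); last first.
  by apply/funext => s; rewrite addr0 mulrC.
by rewrite cpairing_linear// cpairing0 addr0 mulrC.
Qed.

End slices.

(** * Averaging over a set of finite positive measure *)

Section indicator.
Context d (X : measurableType d) (R : realType).
Variable mu : {sigma_finite_measure set X -> \bar R}.

Lemma exists_finite_positive_measure : (0 < mu setT)%E ->
  exists A, [/\ measurable A, (0 < mu A)%E & (mu A < +oo)%E].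
Proof.
move=> mu_gt0; have [F FT Ffin] := sigma_finiteT mu.
apply: contrapT => nA.
have F0 n : mu.-negligible (F n).
  exists (F n); split => //; first exact: (Ffin n).1.
  apply/eqP; rewrite eq_le measure_ge0 andbT leNgt; apply/negP => Fn.
  by apply: nA; exists (F n); split => //; [exact: (Ffin n).1|exact: (Ffin n).2].
have : mu.-negligible (setT : set X) by rewrite FT; exact: negligible_bigcup.
by move=> /(measure_negligible measurableT) mu0; rewrite mu0 ltxx in mu_gt0.
Qed.

Context (A : set X) (mA : measurable A) (A0 : (0 < mu A)%E) (Afin : (mu A < +oo)%E).

Lemma Lnorm_indic (r : R) : 0 < r ->
  ('N[mu]_r%:E[EFin \o \1_A] = mu A `^ (r^-1))%E.
Proof.
move=> r0; rewrite unlock; congr (_ `^ _)%E.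
rewrite -[A in RHS]setIT -integral_indic//.
apply: eq_integral => x _; rewrite /= indicE; case: (x \in A).
  by rewrite normr1 powR1.
by rewrite normr0 powR0// gt_eqF.
Qed.

(** Hoelder's inequality, in a form uniform in the exponent p: the norms of the
    indicator of A for p and for the conjugate exponent multiply to the measure
    of A. *)
Lemma indic_dual (p : \bar R) (k : X -> R) : (1 <= p)%E -> measurable_fun setT k ->
  (\int[mu]_s `|k s * \1_A s|%R%:E * 'N[mu]_p[EFin \o \1_A] <=
   mu A * 'N[mu]_p[EFin \o k])%E.
Proof.
have muA : mu A = (fine (mu A))%:E by rewrite fineK// ge0_fin_numE.
case: p => [r|_|//] => [r1 mk|mk].
  have r0 : 0 < r by rewrite (lt_le_trans ltr01)// -lee_fin.
  move: r1; rewrite lee_fin le_eqVlt => /predU1P[<-|r1].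
    rewrite Lnorm_indic// invr1 poweRe1// muleC lee_wpmul2l// Lnorm1.
    apply: ge0_le_integral => //.
    - apply/measurable_EFinP/measurableT_comp => //.
      exact: measurable_funM.
    - exact/measurable_EFinP/measurableT_comp.
    - move=> x _; rewrite lee_fin normrM ler_piMr// indicE.
      by case: (x \in A); rewrite ?normr1// normr0.
  pose q := r / (r - 1).
  have r10 : 0 < r - 1 by rewrite subr_gt0.
  have q0 : 0 < q by rewrite divr_gt0.
  have rq : r^-1 + q^-1 = 1.
    by rewrite invf_div -[X in X + _]div1r -mulrDl addrC subrK divff ?gt_eqF.
  have := @hoelder _ _ _ mu k \1_A r q mk (measurable_indic mA) r0 q0 rq.
  rewrite Lnorm1 => /(lee_wpmul2r (Lnorm_ge0 mu r%:E (EFin \o \1_A))) /le_trans.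
  apply; rewrite !Lnorm_indic// -muleA [leRHS]muleC lee_wpmul2l//; first exact: Lnorm_ge0.
  rewrite muA !poweR_EFin -EFinM lee_fin -powRD.
    by rewrite addrC rq powRr1// fine_ge0.
  by rewrite addrC rq oner_eq0.
have mu0 : (0 < mu setT)%E.
  by apply: (lt_le_trans A0); apply: le_measure; rewrite ?inE.
apply: (@le_trans _ _ (\int[mu]_s `|k s * \1_A s|%R%:E)%E).
  rewrite -[leRHS]mule1 lee_wpmul2l//; first exact: integral_ge0.
  rewrite unlock mu0; apply/ess_supP/nearW => x /=.
  by rewrite lee_fin indicE; case: (x \in A); rewrite ?normr1// normr0.
have M0 := Lnorm_ge0 mu +oo (EFin \o k).
have mi : measurable_fun setT (EFin \o \1_A : X -> \bar R).
  exact/measurable_EFinP.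
have -> : mu A = (\int[mu]_s (\1_A s)%:E)%E by rewrite integral_indic// setIT.
rewrite -ge0_integralZr//.
apply: ae_ge0_le_integral => //.
- apply/measurable_EFinP/measurableT_comp => //.
  exact: measurable_funM.
- by move=> x _; rewrite mule_ge0.
- exact: emeasurable_funM.
have : \forall x \ae mu, (`|k x|%:E <= 'N[mu]_+oo[EFin \o k])%E.
  by rewrite unlock mu0; exact: ess_sup_ge.
apply: filterS => x /= kx _.
rewrite indicE; case: (x \in A); first by rewrite mulr1 mul1e.
by rewrite mulr0 normr0 mul0e.
Qed.

End indicator.

(** The vector xi is an indicator and S averages over its support; the bound on S
    is the inverse of the norm of xi because the indicator realizes equality in
    Hoelder's inequality. *)
Lemma exists_Lprod_left_inverse d (X : measurableType d) (R : realType)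
    (mu : {sigma_finite_measure set X -> \bar R}) (p : \bar R) (p1 : (1 <= p)%E) :
  (0 < mu setT)%E ->
  exists (xi : Lp mu p1) (S : Lp (mu \x mu)%E p1 -> Lp mu p1),
    [/\ linear S, 0 < rnorm xi, forall eta, S (Lprod xi eta) = eta &
      forall z, rnorm (S z) <= (rnorm xi)^-1 * rnorm z].
Proof.
move=> mu0; have [A [mA A0 Afin]] := exists_finite_positive_measure mu0.
have muA : mu A = (fine (mu A))%:E by rewrite fineK// ge0_fin_numE.
have m0 : 0 < fine (mu A) by rewrite -lte_fin -muA.
pose f (s : X) : R[i] := (\1_A s)%:C%C.
have modf : EFin \o modulus f = EFin \o (\1_A : X -> R).
  apply/funext => s; congr EFin; rewrite /modulus /f /=.
  by rewrite expr0n addr0 sqrtr_sqr ger0_norm.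
have fLp : f \in LpFun mu p1.
  rewrite inE; split.
    by split; [exact: measurable_indic|exact: measurable_cst].
  rewrite /finite_norm modf; case: (p) p1 => [r r1|_|//].
    have r0 : 0 < r by rewrite (lt_le_trans ltr01)// -lee_fin.
    by rewrite Lnorm_indic// poweR_lty.
  rewrite unlock mu0 (@le_lt_trans _ _ 1%E) ?ltry//; apply/ess_supP/nearW => x /=.
  by rewrite lee_fin indicE; case: (x \in A); rewrite ?normr1// normr0.
pose xi := LpFunction fLp.
have Nxi : ('N[mu]_p[EFin \o \1_A] = (lpnorm xi)%:E)%E by rewrite lpnormE /= modf.
have xi0 : 0 < lpnorm xi.
  rewrite lt_neqAle; apply/andP; split; last first.
    by rewrite -lee_fin -Nxi; exact: Lnorm_ge0.
  apply/eqP => /esym /lpnorm_eq0; rewrite -Lclass0 => /Lclass_eq -[N [mN N0 AN]].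
  have : (mu A <= mu N)%E.
    apply: le_measure; rewrite ?inE// => s As; apply: AN => /=.
    rewrite /f indicE mem_set// => /eqP.
    by rewrite -[X in X == _]/(1 : R[i]) oner_eq0.
  by rewrite N0 leNgt A0.
pose psi (s : X) := (fine (mu A))^-1 * \1_A s.
have mpsi : measurable_fun setT psi by exact: measurable_funM.
have C0 : 0 <= (lpnorm xi)^-1 by rewrite invr_ge0 ltW.
have psi_dual (k : X -> R) : measurable_fun setT k ->
    (\int[mu]_s `|k s * psi s|%R%:E <= (lpnorm xi)^-1%:E * 'N[mu]_p[EFin \o k])%E.
  move=> mk; have := indic_dual mA A0 Afin p1 mk.
  rewrite Nxi muA => kA.
  rewrite (_ : (fun s => `|k s * psi s|%R%:E) =
      (fun s => (fine (mu A))^-1%:E * `|k s * \1_A s|%R%:E)%E); last first.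
    apply/funext => s; rewrite -EFinM /psi mulrCA normrM ger0_norm//.
    by rewrite invr_ge0 ltW.
  rewrite ge0_integralZl//; last 2 first.
  - apply/measurable_EFinP/measurableT_comp => //; exact: measurable_funM.
  - by rewrite lee_fin invr_ge0 ltW.
  rewrite lee_pdivrMl// muleA [(_ * _%:E)%E in leRHS]muleC -muleA.
  by rewrite lee_pdivlMl// muleC.
exists (Lclass xi), (@Lslice _ _ _ mu p p1 mu0 psi _ mpsi C0 psi_dual).
rewrite rnorm_Lclass; split => //.
- exact: Lslice_linear.
- move=> eta; rewrite Lslice_Lprod (_ : cpairing _ _ _ = 1) ?scale1r//.
  rewrite [LHS]cpairing_real (_ : pairing _ _ _ = 1)// /pairing.
  rewrite (@eq_Rintegral _ _ _ mu _ (fun s => (fine (mu A))^-1 * \1_A s)).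
    rewrite RintegralZl//; last first.
      apply/integrableP; split; first exact/measurable_EFinP.
      under eq_integral do rewrite gee0_abs ?lee_fin//.
      by rewrite integral_indic// setIT.
    by rewrite /Rintegral integral_indic// setIT mulVf// gt_eqF.
  move=> s _; rewrite /psi mulrCA indicE.
  by case: (s \in A); rewrite ?mulr1// mulr0.
- by move=> z; exact: rnorm_Lslice.
Qed.

Theorem theorem4p7 (R : realType) (d : measure_display) (X : measurableType d)
    (mu : {sigma_finite_measure set X -> \bar R})
    (mu_basis : countable_basis mu) (mu_gt0 : (0 < mu setT)%E)
    (mu_atoms : no_atoms mu \/ one_atom mu \/ infinitely_many_atoms mu)
    (p : \bar R) (p1 : (1 <= p)%E)
    (i : {linear Lp (mu \x mu)%E p1 -> Lp mu p1}) (i_iso : isometric_iso i)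
    (E : normedModType R[i]) (F : Ldata (Lp mu p1)) (F_Lspace : is_Lspace F) :
  exists I : {linear Ltensor (fun xi eta => i (Lprod xi eta)) (Lmax (Lp mu p1) E) F
                     -> Lpr E F},
    L_isometric_iso I /\ forall z : tensor E F, I z = z.
Proof.
have [[j ij ji] i_norm] := i_iso.
have rnorm_i z : rnorm (i z) = rnorm z by rewrite /rnorm i_norm.
have dia_bilinear : bilinear_map (fun xi eta => i (@Lprod _ _ _ mu p p1 xi eta)).
  have [bl br] := Lprod_bilinear mu p1.
  by split=> [xi a u v|eta a u v]; rewrite ?bl ?br linearP.
have dia_le xi eta : rnorm (i (Lprod xi eta)) <= rnorm xi * rnorm eta.
  rewrite rnorm_i; elim/Lclass_ind: xi => f; elim/Lclass_ind: eta => g.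
  by rewrite LprodE !rnorm_Lclass; exact: lpnorm_lpprod.
have [xi [S [linS xi0 Sxi Sle]]] := exists_Lprod_left_inverse p1 mu_gt0.
have j_linear : linear j.
  by move=> a u v; apply: (can_inj ij); rewrite linearP !ji.
have [a aE] := linear_of (linear_compf linS j_linear).
have a_le z : rnorm (a z) <= (rnorm xi)^-1 * rnorm z.
  by rewrite aE (le_trans (Sle _))// -[in leRHS](ji z) rnorm_i.
have a_bounded : exists M : R, forall z, rnorm (a z) <= M * rnorm z.
  by exists (rnorm xi)^-1.
exists idfun; split => //.
apply: (@L_isometric_id _ _ _ dia_bilinear dia_le E F F_Lspace xi
  (BoundedOp a_bounded)).
- by move=> eta; rewrite /= aE ij Sxi.
- have xi_ge0 : 0 <= (rnorm xi)^-1 by rewrite invr_ge0 ltW.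
  by rewrite -ler_pdivlMr// div1r; exact: opnorm_le.
Qed.
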